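(* Let $\mathcal{G}$ and $\mathcal{H}$ be compact metric graphs with $\delta$-type vertex conditions. (1) (Attaching a pendant graph) Suppose $\widetilde{\mathcal{G}}$ is formed from $\mathcal{G}$ by attaching the pendant graph $\mathcal{H}$ at a vertex $v_0$ of $\mathcal{G}$. If, for some $r\ge1$ and $k\ge1$, $\lambda_r(\mathcal{H})\le\lambda_k(\mathcal{G})$, then $$\lambda_{k+r-1}(\widetilde{\mathcal{G}})\le\lambda_k(\mathcal{G}).$$ This inequality is strict if the eigenvalue $\lambda_k(\mathcal{G})$ has an eigenfunction which does not vanish at $v_0$, $\lambda_k(\mathcal{G})>\lambda_{k-1}(\mathcal{G})$ and $\lambda_k(\mathcal{G})>\lambda_r(\mathcal{H})$. (2) (Inserting a graph at a vertex) Suppose $\widetilde{\mathcal{G}}$ is formed by inserting $\mathcal{H}$ at a vertex $v_0$ of $\mathcal{G}$, where only natural conditions were imposed at the vertices of $\mathcal{H}$ prior to insertion. Then, for all $k$ such that $\lambda_k(\mathcal{G})\ge0$, $$\lambda_k(\widetilde{\mathcal{G}})\le\lambda_k(\mathcal{G}).$$ This inequality is strict if $\lambda_k(\mathcal{G})>\max(0,\lambda_{k-1}(\mathcal{G}))$ and the eigenvalue $\lambda_k(\mathcal{G})$ has an eigenfunction which does not vanish at $v_0$.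
   Context: A compact metric graph $\mathcal{G}$ has finitely many vertices and edges, each edge $e$ being identified with an interval $[0,|e|]$, $0<|e|<\infty$; loops and multiple edges are allowed and $\mathcal{G}$ need not be connected. Each vertex $v$ carries a strength $\gamma(v)\in(-\infty,\infty]$: $\gamma(v)=0$ is the natural condition, $\gamma(v)\in\mathbb{R}\setminus\{0\}$ is a $\delta$-condition, $\gamma(v)=\infty$ is the Dirichlet condition. The associated Laplacian is $-d^2/dx^2$ on each edge, on edgewise $H^2$-functions $f$ that are continuous at the vertices and satisfy $\sum_{e\sim v}\partial_\nu f|_e(v)+\gamma(v)f(v)=0$ (with $\partial_\nu$ the derivative pointing out of the edge towards $v$) if $\gamma(v)<\infty$, and $f(v)=0$ if $\gamma(v)=\infty$. Its quadratic form is $a(f)=\int_{\mathcal{G}}|f'|^2\,dx+\sum_{v:\gamma(v)<\infty}\gamma(v)|f(v)|^2$ on the functions which are $H^1$ on every edge, continuous on $\mathcal{G}$ and zero at all Dirichlet vertices. The operator is self-adjoint, bounded below, with discrete spectrum $\lambda_1(\mathcal{G})\le\lambda_2(\mathcal{G})\le\dots$ (repeated according to multiplicity). Convention: $\lambda_0(\mathcal{G})=-\infty$. Gluing vertices $v_1,\dots,v_m$ means identifying them to a single vertex $v_0$ with strength $\gamma(v_0)=\gamma(v_1)+\dots+\gamma(v_m)$ (with $\gamma+\infty=\infty$, $\infty+\infty=\infty$). Attaching a pendant graph $\mathcal{H}$ to $\mathcal{G}$ at $v_0$: a vertex $w_1$ of $\mathcal{H}$ is distinguished, and $v_0$ and $w_1$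 are glued. Inserting $\mathcal{H}$ into $\mathcal{G}$ at $v_0$ (where $\gamma(v_0)\in(-\infty,\infty)$): if $e_1,\dots,e_d$ are the edges incident with $v_0$ (a loop counting as two edge ends), remove $v_0$ and attach, for each $i$, the edge end $e_i$ to some vertex $w(i)$ of $\mathcal{H}$ instead; if $w_1,\dots,w_m$ is the list of vertices of $\mathcal{H}$ so used, $\delta$-conditions with strengths summing to $\gamma(v_0)$ are placed at $w_1,\dots,w_m$. All other vertex conditions are unchanged. *)

(* Defs.v *)
From HB Require Import structures.
From mathcomp Require Import all_boot all_order all_algebra.
From mathcomp Require Import all_classical all_reals all_analysis.

Set Implicit Arguments.
Unset Strict Implicit.
Unset Printing Implicit Defensive.

Import Order.TTheory GRing.Theory Num.Theory.

Local Open Scope ring_scope.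

(** ** Compact metric graphs with delta-type vertex conditions *)

(* The edge [e] is the interval [0, len e]; [edge_end e false] is the vertex at
   its end 0 and [edge_end e true] the vertex at its end [len e], so that loops
   and multiple edges are allowed.  Strength [+oo] is the Dirichlet condition.
   At least one edge is required: otherwise L^2 of the graph is the zero space
   and there is no spectrum. *)
Record metric_graph (R : realType) := MetricGraph {
  vertex : finType;
  edge : finType;
  edge_end : edge -> bool -> vertex;
  len : edge -> R;
  strength : vertex -> \bar R;
  len_gt0 : forall e, 0 < len e;
  strength_neqNy : forall v, strength v != -oo%E;
  edge_gt0 : (0 < #|edge|)%N
}.
Arguments edge_end {R} G e b : rename.
Arguments len {R} G e : rename.
Arguments strength {R} G v : rename.

(** ** Sobolev functions on an interval *)

Definition L2_on (R : realType) (l : R) (g : R -> R) : Prop :=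
  measurable_fun `[0, l]%classic g /\
  (@lebesgue_measure R).-integrable `[0, l]%classic
    (fun x => (g x ^+ 2)%:E).

(* [f] is the continuous representative of an H^1 function on [0, l], with
   weak derivative [f']. *)
Definition H1_on (R : realType) (l : R) (f f' : R -> R) : Prop :=
  L2_on l f' /\
  forall x, 0 <= x <= l ->
    f x = f 0 + \int[@lebesgue_measure R]_(t in `[0, x]%classic) f' t.

(* [f'] is here the continuous representative of the first derivative, so that
   its values at 0 and [l] are meaningful. *)
Definition H2_on (R : realType) (l : R) (f f' f'' : R -> R) : Prop :=
  H1_on l f f' /\ H1_on l f' f''.

(** ** The Laplacian and its eigenvalues *)

Section Laplacian.
Context {R : realType}.
Variable G : metric_graph R.

(* A function on the graph; only the values of [f e] on [0, len e] matter. *)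
Definition graph_fun := edge G -> R -> R.

Definition end_value (f : graph_fun) (e : edge G) (b : bool) : R :=
  f e (if b then len G e else 0).

(* The derivative at an edge end, pointing out of the edge towards the vertex,
   computed from the edgewise derivative [f']. *)
Definition end_deriv (f' : graph_fun) (e : edge G) (b : bool) : R :=
  if b then f' e (len G e) else - f' e 0.

(* [c] is the common value f(v) at [v].  If no edge is incident with [v] the
   condition is void, as c = 0 satisfies it. *)
Definition vertex_condition (f f' : graph_fun) (v : vertex G) : Prop :=
  exists c : R,
    (forall e b, edge_end G e b = v -> end_value f e b = c) /\
    (if strength G v is g%:E then
       \sum_(e : edge G) \sum_(b : bool | edge_end G e b == v)
          end_deriv f' e b + g * c = 0
     else c = 0).

(* f is in the domain of the Laplacian, which maps it to u. *)
Definition laplacian (f u : graph_fun) : Prop :=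
  exists f' f'' : graph_fun,
    [/\ forall e, H2_on (len G e) (f e) (f' e) (f'' e),
        forall e, {ae @lebesgue_measure R,
          forall x, 0 <= x <= len G e -> u e x = - f'' e x}
      & forall v, vertex_condition f f' v].

(* The solutions of the eigenvalue equation, 0 included. *)
Definition eigenspace (mu : R) (f : graph_fun) : Prop :=
  laplacian f (fun e x => mu * f e x).

Definition eigenfunction (mu : R) (f : graph_fun) : Prop :=
  eigenspace mu f /\ exists e x, 0 <= x <= len G e /\ f e x != 0.

Definition nonvanishing_at (v : vertex G) (f : graph_fun) : Prop :=
  exists e b, edge_end G e b = v /\ end_value f e b != 0.

Definition lin_indep n (f : 'I_n -> graph_fun) : Prop :=
  forall c : 'I_n -> R,
    (forall e x, 0 <= x <= len G e -> \sum_(i < n) c i * f i e x = 0) ->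
    forall i, c i = 0.

(* Since eigenfunctions for distinct eigenvalues are linearly independent, this
   says that at least [n] eigenvalues, repeated according to their
   multiplicity, are at most [mu]. *)
Definition eigenvalues_below (n : nat) (mu : R) : Prop :=
  exists (nu : 'I_n -> R) (f : 'I_n -> graph_fun),
    [/\ forall i, nu i <= mu,
        forall i, eigenfunction (nu i) (f i)
      & lin_indep f].

(* The [k]-th eigenvalue, k = 1, 2, ..., repeated according to multiplicity. *)
Definition lambda (k : nat) : \bar R :=
  ereal_inf [set mu%:E | mu in eigenvalues_below k]%classic.

Lemma lambda0 : lambda 0 = -oo%E.
Proof.
rewrite /lambda (_ : eigenvalues_below 0 = setT) ?ereal_inf_real//.
rewrite -subTset => mu _; exists (fun=> 0), (fun _ _ _ => 0).
by split=> [[]|[]|? ? []].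
Qed.

Definition has_eigenfunction_nonvanishing_at (v : vertex G) (k : nat) : Prop :=
  exists (mu : R) (f : graph_fun),
    [/\ lambda k = mu%:E, eigenfunction mu f & nonvanishing_at v f].

End Laplacian.

(** ** Surgery *)

Section Surgery.
Context {R : realType}.

Section DisjointUnion.
Variables G H : metric_graph R.

Definition union_end (e : edge G + edge H) (b : bool) : vertex G + vertex H :=
  match e with
  | inl e => inl (edge_end G e b)
  | inr e => inr (edge_end H e b)
  end.

Definition union_len (e : edge G + edge H) : R :=
  match e with inl e => len G e | inr e => len H e end.

Definition union_strength (v : vertex G + vertex H) : \bar R :=
  match v with inl v => strength G v | inr v => strength H v end.

Lemma union_len_gt0 e : 0 < union_len e.
Proof. by case: e => e; apply: len_gt0. Qed.

Lemma union_strength_neqNy v : union_strength v != -oo%E.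
Proof. by case: v => v; apply: strength_neqNy. Qed.

Lemma union_edge_gt0 : (0 < #|{: edge G + edge H}|)%N.
Proof. by rewrite card_sum addn_gt0 edge_gt0. Qed.

Definition disjoint_union : metric_graph R :=
  @MetricGraph R (vertex G + vertex H)%type (edge G + edge H)%type
    union_end union_len union_strength
    union_len_gt0 union_strength_neqNy union_edge_gt0.

End DisjointUnion.

(* The vertices in [S] are identified to the single vertex [None]. *)
Section Gluing.
Variables (G : metric_graph R) (S : pred (vertex G)).

Definition glue_proj (v : vertex G) : option {u : vertex G | ~~ S u} := insub v.

Definition glue_strength (v : option {u : vertex G | ~~ S u}) : \bar R :=
  match v with
  | Some u => strength G (val u)
  | None => (\sum_(u | S u) strength G u)%E
  end.

Lemma glue_strength_neqNy v : glue_strength v != -oo%E.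
Proof.
case: v => [u|] /=; first exact: strength_neqNy.
rewrite esum_eqNy; apply/existsP => -[u /andP[_]].
by rewrite (negbTE (strength_neqNy _)).
Qed.

Definition glue : metric_graph R :=
  @MetricGraph R (option {u : vertex G | ~~ S u}) (edge G)
    (fun e b => glue_proj (edge_end G e b)) (len G) glue_strength
    (@len_gt0 R G) glue_strength_neqNy (edge_gt0 G).

End Gluing.

(* Attaching the pendant graph [H] to [G]: [w1] is glued to [v0]. *)
Definition attach (G H : metric_graph R) (v0 : vertex G) (w1 : vertex H) :
    metric_graph R :=
  @glue (disjoint_union G H) [pred v | (v == inl v0) || (v == inr w1)].

(* Inserting [H] into [G] at [v0].  The edge end (e, b) of [G] at [v0] is moved
   to the vertex [w e b] of [H]; the values of [w] at the other edge ends are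
   irrelevant, and so are those of [s] at the vertices of [H] which receive no
   edge end. *)
Section Insertion.
Variables (G H : metric_graph R) (v0 : vertex G).
Variables (w : edge G -> bool -> vertex H) (s : vertex H -> R).

Definition insert_used : pred (vertex H) :=
  [pred u | [exists e, exists b, (edge_end G e b == v0) && (w e b == u)]].

Definition insert_end (e : edge G + edge H) (b : bool) :
    {v : vertex G | v != v0} + vertex H :=
  match e with
  | inl e => if insub (edge_end G e b) is Some v then inl v else inr (w e b)
  | inr e => inr (edge_end H e b)
  end.

Definition insert_strength (v : {v : vertex G | v != v0} + vertex H) : \bar R :=
  match v with
  | inl v => strength G (val v)
  | inr u => if insert_used u then (s u)%:E else strength H u
  end.

Lemma insert_strength_neqNy v : insert_strength v != -oo%E.
Proof.
case: v => v /=; first exact: strength_neqNy.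
by case: ifP => // _; apply: strength_neqNy.
Qed.

Definition insert : metric_graph R :=
  @MetricGraph R ({v : vertex G | v != v0} + vertex H)%type
    (edge G + edge H)%type insert_end (@union_len G H) insert_strength
    (@union_len_gt0 G H) insert_strength_neqNy (union_edge_gt0 G H).

End Insertion.

End Surgery.

(* Main.v *)
(* Write a(f) - mu |f|^2 for the quadratic form shifted by mu.  A linear
   combination of eigenfunctions with eigenvalues at most mu makes it
   nonpositive.  Pairs of such combinations on G and H which agree at the glued
   vertices form a space of dimension at least k + r - 1 on the pendant graph;
   for an insertion, a combination on G is continued by its value at v0 over all
   of H, which costs nothing if mu >= 0.  In the strict cases a vanishing form
   leaves only multiples of the given eigenfunction, and those are excluded by
   its value at v0.

   It remains to find n eigenvalues at most mu whenever the shifted form is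
   nonpositive on an n-dimensional space of test functions.  Cut the edges into
   segments so short that for every l <= mu + 1 the equation u'' = - l u is
   solvable with arbitrary end values.  Minimising over functions with
   prescribed nodal values turns the form into an explicit quadratic form M(l)
   on a finite-dimensional space, continuous in l and positive definite for very
   negative l; its kernel is the eigenspace of l, and M(mu) is nonpositive on
   the nodal values of the test functions.  As l increases to mu, the maximal
   dimension of a nonpositive subspace grows from 0 to at least n, and each
   growth is paid for by a kernel. *)

Require Import Defs.
From HB Require Import structures.
From mathcomp Require Import all_boot all_order all_algebra.
From mathcomp Require Import all_classical all_reals all_analysis.
From mathcomp Require Import measurable_realfun.
From mathcomp Require Import ring lra.

Set Implicit Arguments.
Unset Strict Implicit.
Unset Printing Implicit Defensive.

Import Order.TTheory GRing.Theory Num.Theory.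
Import numFieldNormedType.Exports.

Local Open Scope ring_scope.
Local Open Scope classical_set_scope.

(** * Real quadratic forms *)

(** [lambda] is an infimum over exhibited eigenfunctions, so an upper bound has to construct them;
    hence the count in finite dimensions, where eigenfunctions arise from kernels. The count rests
    on semicontinuity. Directions on which the form is positive stay positive nearby, so the
    nonpositive index cannot rise just after a point; negative directions at a point are already
    negative just before it, so the rise there is at most the dimension of the kernel. For the same
    reason strict negativity at mu is visible before mu, which yields the strict inequalities.
    Neither completeness of the eigenfunctions nor minimisers in H^1 enter: eigenfunctions are
    explicit solutions on each edge, extended to the whole line, so all test functions are of class
    C^1 and the integrals in the form have continuous integrands. *)

Section QuadraticForms.
Variable F : realFieldType.

Definition qform n (M : 'M[F]_n) (x : 'rV_n) : F := (x *m M *m x^T) 0 0.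

Lemma row_free_subspace m n p (K : 'M[F]_(m, p)) : (n <= \rank K)%N ->
  exists X : 'M[F]_(n, p), row_free X /\ (X <= K)%MS.
Proof.
move=> nK; exists (pid_mx n *m row_base K); split.
  by rewrite /row_free mxrankMfree ?row_base_free// rank_pid_mx.
by rewrite (submx_trans (submxMl _ _))// eq_row_base.
Qed.

(** One linear equation costs at most one dimension. Applied to the gluing equation, this is the
    origin of the -1 in [k + r - 1]. *)
Lemma row_free_kernel n p (u : 'cV[F]_p) : (n <= p.-1)%N ->
  exists X : 'M[F]_(n, p), row_free X /\ X *m u = 0.
Proof.
move=> np; have [|X [fX XK]] := @row_free_subspace _ n _ (kermx u).
  rewrite mxrank_ker (leq_trans np)// -subn1 leq_sub2l//.
  exact: rank_leq_col.
by exists X; split=> //; apply/sub_kermxP.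
Qed.

Lemma qform_mx n p (V : 'M[F]_(p, n)) M x :
  qform (V *m M *m V^T) x = qform M (x *m V).
Proof. by rewrite /qform trmx_mul !mulmxA. Qed.

Lemma qform_diag n (d x : 'rV[F]_n) :
  qform (diag_mx d) x = \sum_i d 0 i * x 0 i ^+ 2.
Proof.
rewrite /qform mxE; apply: eq_bigr => i _.
by rewrite mul_mx_diag !mxE; ring.
Qed.

Lemma qform_sum n (M : 'M[F]_n) x :
  qform M x = \sum_i \sum_j x 0 i * M i j * x 0 j.
Proof.
rewrite /qform mxE exchange_big/=; apply: eq_bigr => j _.
by rewrite !mxE mulr_suml.
Qed.

(** If the diagonal entries at [i] and [j] vanish, the form at ['e_i + 'e_j] is twice the nonzero
    entry [M i j]. *)
Lemma qform_anisotropic n (M : 'M[F]_n) : M^T = M -> M != 0 ->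
  exists v, qform M v != 0.
Proof.
move=> Ms /matrix0Pn[i [j Mij]].
have bE k l : 'e_k *m M *m ('e_l)^T = (M k l)%:M :> 'M[F]_1.
  by rewrite -rowE trmx_delta -colE; apply/matrixP => a b; rewrite !mxE !ord1.
have Mji : M j i = M i j by rewrite -[in LHS]Ms mxE.
have [Mii|] := eqVneq (M i i) 0; last first.
  by exists 'e_i; rewrite /qform bE mxE.
have [Mjj|] := eqVneq (M j j) 0; last first.
  by exists 'e_j; rewrite /qform bE mxE.
exists ('e_i + 'e_j).
rewrite /qform linearD/= mulmxDl mulmxDr !mulmxDl !bE Mii Mjj Mji !mxE/=.
by rewrite add0r addr0 -mulr2n mulrn_eq0.
Qed.

(** Lagrange reduction: split off an anisotropic vector [v] and continue on its orthogonal
    complement for [M]. Congruence is enough, as only the signs of the diagonal matter. *)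
Lemma symmetric_diagonalization n (M : 'M[F]_n) : M^T = M ->
  exists (P : 'M[F]_n) (d : 'rV_n),
    P \in unitmx /\ P *m M *m P^T = diag_mx d.
Proof.
elim: n M => [|n IHn] M Ms.
  by exists 1%:M, 0; split; [exact: unitmx1 | by apply/matrixP => -[]].
have [->|M0] := eqVneq M 0.
  exists 1%:M, 0; split; first exact: unitmx1.
  by rewrite mulmx0 mul0mx raddf0.
have [v qv] := qform_anisotropic Ms M0.
have [W [fW WK]] := @row_free_kernel n n.+1 (M *m v^T) (leqnn _).
have vMv : v *m M *m v^T = (qform M v)%:M by rewrite [LHS]mx11_scalar.
have WMv : W *m M *m v^T = 0 by rewrite -mulmxA.
have vMW : v *m M *m W^T = 0.
  by apply: trmx_inj; rewrite !trmx_mul trmxK Ms trmx0 mulmxA.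
have [P' [d' [Pu PM]]] : exists (P : 'M[F]_n) (d : 'rV_n),
    P \in unitmx /\ P *m (W *m M *m W^T) *m P^T = diag_mx d.
  by apply: IHn; rewrite !trmx_mul trmxK Ms mulmxA.
exists (col_mx v (P' *m W) : 'M[F]_(1 + n)), (row_mx (qform M v)%:M d').
split; last first.
  rewrite -[n.+1]/(1 + n)%N diag_mx_row mul_col_mx tr_col_mx mul_col_row.
  rewrite vMv !trmx_mul !mulmxA vMW mul0mx.
  rewrite -(mulmxA P') -(mulmxA P') WMv mulmx0 -PM !mulmxA.
  congr block_mx; apply/matrixP => i j; rewrite !ord1 !mxE//=.
rewrite -row_free_unit; apply: inj_row_free => x.
rewrite -[n.+1]/(1 + n)%N in x *.
rewrite -(hsubmxK x) mul_row_col => h.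
(* Pairing with [v] through [M] isolates the coefficient of [v], because [W] is orthogonal to
   [v]. *)
have l0 : lsubmx x = 0.
  have := congr1 (fun y => y *m (M *m v^T)) h.
  rewrite mulmxDl mul0mx -!mulmxA [W *m _]mulmxA WMv !mulmx0 addr0 [v *m _]mulmxA vMv.
  move/matrixP/(_ 0 0); rewrite mul_mx_scalar !mxE.
  move=> /eqP; rewrite mulf_eq0 (negbTE qv)/= => /eqP h0.
  by apply/matrixP => i j; rewrite !ord1 !mxE.
move: h; rewrite l0 mul0mx add0r mulmxA => /eqP.
rewrite -[X in _ == X](mul0mx _ W) => /eqP/(row_free_inj fW) /eqP.
rewrite -[X in _ == X](mul0mx _ P') => /eqP h.
have := row_free_inj _ h; rewrite row_free_unit => /(_ Pu) ->.
by rewrite row_mx0.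
Qed.

Lemma row_free_rowsub n m p (f : 'I_m -> 'I_n) (P : 'M[F]_(n, p)) :
  injective f -> row_free P -> row_free (rowsub f P).
Proof.
move=> fi fP; apply: inj_row_free => x; rewrite rowsubE mulmxA => /eqP.
rewrite -[X in _ == X](mul0mx _ P) => /eqP/(row_free_inj fP) h.
apply/rowP => i; move/rowP/(_ (f i)): h; rewrite !mxE => <-.
rewrite (bigD1 i)//= big1 => [|j ji]; rewrite !mxE ?eqxx ?mulr1 ?addr0//.
by rewrite (inj_eq fi) (negbTE ji) mulr0.
Qed.

Lemma diag_rowsub n m (f : 'I_m -> 'I_n) (P M : 'M[F]_n) d :
  injective f -> P *m M *m P^T = diag_mx d ->
  rowsub f P *m M *m (rowsub f P)^T = diag_mx (colsub f d).
Proof.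
move=> fi PM; apply/matrixP => i j.
move/matrixP/(_ (f i) (f j)): PM.
rewrite !mxE (inj_eq fi) => <-.
apply: eq_bigr => k _; rewrite !mxE; congr (_ * _).
by apply: eq_bigr => l _; rewrite !mxE.
Qed.

(** A common nonzero vector would make the form both nonpositive and positive, so the two row spaces
    are in direct sum. *)
Lemma leq_dim_opposite n p q (U : 'M[F]_(p, n)) (V : 'M[F]_(q, n))
    (M : 'M[F]_n) : row_free U -> row_free V ->
  (forall x, x != 0 -> qform M (x *m U) <= 0) ->
  (forall x, x != 0 -> 0 < qform M (x *m V)) ->
  (p + q <= n)%N.
Proof.
move=> fU fV hU hV.
have UV0 : (U :&: V == (0 : 'M[F]_n))%MS.
  rewrite sub0mx andbT submx0; apply/rowV0P => w.
  rewrite sub_capmx => /andP[/submxP[x wx] /submxP[y wy]].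
  have [|y0] := eqVneq y 0; first by move=> y0; rewrite wy y0 mul0mx.
  have x0 : x != 0.
    apply: contra_neq y0 => x0; apply: (row_free_inj fV).
    by rewrite mul0mx -wy wx x0 mul0mx.
  by have := hV _ y0; rewrite -wy wx ltNge hU.
have := mxrank_disjoint_sum (eqP (_ : (U :&: V)%MS == 0)).
rewrite -submx0; case/andP: UV0 => -> _ /(_ isT).
rewrite (eqP fU) (eqP fV) => <-.
exact: rank_leq_col.
Qed.

End QuadraticForms.

(** * Counting the zeros of a pencil of quadratic forms *)

Section Crossing.
Variable R : realType.

(** The supremum of the points up to which [P] holds satisfies [P] by the last hypothesis, and it
    cannot lie before [b] by the one preceding it. *)
Lemma real_induction (a b : R) (P : R -> Prop) : a <= b -> P a ->
  (forall t, a <= t < b -> P t ->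
     exists2 e, 0 < e & forall s, t < s < t + e -> P s) ->
  (forall t, a < t <= b -> (forall s, a <= s < t -> P s) -> P t) ->
  P b.
Proof.
move=> ab Pa Pr Pl.
pose A := [set t | a <= t <= b /\ forall s, a <= s <= t -> P s].
have Aa : A a.
  by split=> [|s /le_anti <-//]; rewrite lexx.
have Aub : ubound A b by move=> t [/andP[]].
have Asup : has_sup A by split; [exists a | exists b].
have asup : a <= sup A by apply: sup_upper_bound.
have supb : sup A <= b by apply: ge_sup => //; exists a.
have Plt s : a <= s < sup A -> P s.
  move=> /andP[as_ sA]; have e0 : 0 < sup A - s by rewrite subr_gt0.
  have [t [_ tP] ] := sup_adherent e0 Asup.
  by rewrite subKr => st; apply: tP; rewrite as_ ltW.
have Psup : P (sup A).
  move: asup; rewrite le_eqVlt => /predU1P[<-//|asup].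
  by apply: Pl => //; rewrite asup.
have [->//|supNb] := eqVneq b (sup A).
have supltb : sup A < b by rewrite lt_neqAle eq_sym supNb.
have [|e e0 Pe] := Pr (sup A) _ Psup; first by rewrite asup.
(* Half of [e] keeps the new point strictly inside the interval on which [P] has been extended. *)
pose t := Num.min b (sup A + e / 2).
have At : A t.
  have supt : sup A <= t by rewrite le_min supb lerDl divr_ge0// ltW.
  split=> [|s /andP[as_ st]]; first by rewrite (le_trans asup)//= ge_min lexx.
  have [sA|sA] := ltP s (sup A); first by apply: Plt; rewrite as_.
  move: sA; rewrite le_eqVlt => /predU1P[<-//|sA].
  apply: Pe; rewrite sA (le_lt_trans st)//.
  by rewrite (@le_lt_trans _ _ (sup A + e / 2)) ?ge_min ?lexx ?orbT//; lra.
have : t <= sup A by apply: sup_upper_bound.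
by rewrite ge_min leNgt supltb/= leNgt ltrDl divr_gt0.
Qed.

(** By [2 |x_i x_j| <= x_i^2 + x_j^2] the perturbation costs at most [eta] times the square norm of
    [x]: the [p] terms of each row absorb the factor [1 / p]. *)
Lemma diag_dominance p (A : 'M[R]_p) (d : 'rV_p) eta : 0 < eta ->
  (forall i, eta < d 0 i) ->
  (forall i j, `|A i j - diag_mx d i j| <= eta / p%:R) ->
  forall x, x != 0 -> 0 < qform A x.
Proof.
move=> eta0 deta Ad x x0.
have p0 : (0 < p%:R :> R).
  rewrite ltr0n lt0n; apply: contraNneq x0 => p0.
  by apply/eqP/rowP => -[i ip]; exfalso; rewrite p0 in ip.
have Aij i j : - (eta / p%:R / 2 * (x 0 i ^+ 2 + x 0 j ^+ 2)) <=
    x 0 i * A i j * x 0 j - x 0 i * diag_mx d i j * x 0 j.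
  rewrite -[X in _ <= X]opprK lerN2 (_ : - _ = - (x 0 i * x 0 j) *
    (A i j - diag_mx d i j)); last by ring.
  rewrite (le_trans (ler_norm _))// normrM normrN normrM.
  rewrite (le_trans (ler_wpM2l _ (Ad i j)))//.
  rewrite mulrC -mulrA ler_wpM2l//; first by rewrite divr_ge0 ?ltW.
  rewrite -(real_normK (num_real (x 0 i))) -(real_normK (num_real (x 0 j))).
  have := sqr_ge0 (`|x 0 i| - `|x 0 j|); lra.
have -> : qform A x = qform (diag_mx d) x +
    \sum_i \sum_j (x 0 i * A i j * x 0 j - x 0 i * diag_mx d i j * x 0 j).
  rewrite !qform_sum -big_split/=; apply: eq_bigr => i _.
  by rewrite -big_split/=; apply: eq_bigr => j _; ring.
apply: (@lt_le_trans _ _ (qform (diag_mx d) x - \sum_i eta * x 0 i ^+ 2)).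
  rewrite qform_diag -sumrB.
  have [i xi] : exists i, x 0 i != 0.
    by apply/rV0Pn.
  rewrite (bigD1 i)//= ltr_pwDl//.
    by rewrite -mulrBl mulr_gt0 ?subr_gt0// exprn_even_gt0.
  by apply: sumr_ge0 => j _; rewrite -mulrBl mulr_ge0 ?subr_ge0 ?sqr_ge0// ltW.
rewrite lerD2l.
apply: le_trans (ler_sum _ (fun i _ => ler_sum _ (fun j _ => Aij i j))).
rewrite le_eqVlt; apply/orP; left; apply/eqP.
have rowE i : \sum_j - (eta / p%:R / 2 * (x 0 i ^+ 2 + x 0 j ^+ 2)) =
    - (eta / p%:R / 2 * (p%:R * x 0 i ^+ 2 + \sum_j x 0 j ^+ 2)).
  by rewrite sumrN -mulr_sumr big_split/= sumr_const card_ord mulr_natl.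
under [RHS]eq_bigr do rewrite rowE.
rewrite sumrN -!mulr_sumr big_split/= sumr_const card_ord -mulr_sumr.
rewrite -mulr_natl; field.
by rewrite gt_eqF.
Qed.

Lemma qform_gt0_near n p (M : R -> 'M[R]_n) (V : 'M[R]_(p, n)) d t :
  (forall i j, {for t, continuous (fun s => M s i j)}) ->
  V *m M t *m V^T = diag_mx d -> (forall i, 0 < d 0 i) ->
  \forall s \near t, forall x, x != 0 -> 0 < qform (M s) (x *m V).
Proof.
move=> Mc VM d0.
(* Half the least diagonal entry, capped at 1 so that the minimum also makes sense for [p = 0]. *)
pose eta := \big[Num.min/1]_i d 0 i / 2.
have eta0 : 0 < eta.
  by rewrite divr_gt0//; elim/big_ind: _ => // x y x0 y0; rewrite lt_min x0.
have etad i : eta < d 0 i.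
  rewrite /eta ltr_pdivrMr// (@le_lt_trans _ _ (d 0 i)) ?bigmin_le_cond//.
  by rewrite ltr_pMr ?ltr1n.
have cA i j : (V *m M s *m V^T) i j @[s --> t] --> (V *m M t *m V^T) i j.
  under eq_fun do rewrite mxE; rewrite mxE.
  apply: cvg_big => [|k _]; first exact: add_continuous.
  apply: cvgM; last exact: cvg_cst.
  under eq_fun do rewrite mxE; rewrite mxE.
  apply: cvg_big => [|l _]; first exact: add_continuous.
  by apply: cvgM; [exact: cvg_cst | exact: Mc].
have near_ij i j : \forall s \near t,
    `|(V *m M s *m V^T) i j - diag_mx d i j| <= eta / p%:R.
  have [p0|p0] := posnP p; first by exfalso; case: i => i; rewrite p0.
  rewrite -VM; move/cvgrPdistC_le: (cA i j); apply.
  by rewrite divr_gt0// ltr0n.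
have := filter_forall (nbhs_filter t) (fun ij => near_ij ij.1 ij.2).
apply: filterS => s sP x x0; rewrite -qform_mx.
by apply: (@diag_dominance _ _ d eta) => // i j; exact: (sP (i, j)).
Qed.

(* [K m t] stands for: at least m eigenvalues are at most t.  A nonpositive
   subspace of [M t] can only grow at a point where [M t] is singular, and then
   at most by the dimension of the kernel, so real induction on t applies. *)
Section Count.
Variables (n : nat) (M : R -> 'M[R]_n) (K : nat -> R -> Prop) (a b : R).
Hypothesis Ms : forall t, (M t)^T = M t.
Hypothesis Mc : forall t, a <= t <= b -> forall i j,
  {for t, continuous (fun s => M s i j)}.
Hypothesis Ma : forall x, x != 0 -> 0 < qform (M a) x.
Hypothesis K0 : forall t, K 0 t.
Hypothesis K_leq : forall m m' t, (m' <= m)%N -> K m t -> K m' t.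
Hypothesis K_le : forall m t t', t <= t' -> K m t -> K m t'.
Hypothesis K_ker : forall m m' t s (X : 'M[R]_(m', n)), a <= t <= b -> s < t ->
  row_free X -> X *m M t = 0 -> K m s -> K (m + m') t.

Let index_count t := forall m (U : 'M[R]_(m, n)), row_free U ->
  (forall x, qform (M t) (x *m U) <= 0) -> K m t.

(** Used to select the rows of a diagonalising matrix whose diagonal entries have a prescribed
    sign. *)
Let spread (f : 'I_n -> bool) : 'I_#|f| -> 'I_n := enum_val.

Let spread_inj f : injective (@spread f).
Proof. exact: enum_val_inj. Qed.

Let spreadP f i : f (@spread f i).
Proof. exact: (enum_valP i). Qed.

Let spread_diag (P : 'M[R]_n) d t f : P *m M t *m P^T = diag_mx d ->
  let V := rowsub (@spread f) P in
  V *m M t *m V^T = diag_mx (colsub (@spread f) d).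
Proof. by move=> PM; exact: diag_rowsub. Qed.

Let diag_gt0 m (d : 'rV[R]_m) : (forall i, 0 < d 0 i) ->
  forall x, x != 0 -> 0 < qform (diag_mx d) x.
Proof.
move=> d0 x /rV0Pn[i xi]; rewrite qform_diag (bigD1 i)//= ltr_pwDl//.
  by rewrite mulr_gt0// exprn_even_gt0.
by apply: sumr_ge0 => j _; rewrite mulr_ge0 ?sqr_ge0// ltW.
Qed.

Let diag_le0 m (d : 'rV[R]_m) : (forall i, d 0 i <= 0) ->
  forall x, qform (diag_mx d) x <= 0.
Proof.
move=> d0 x; rewrite qform_diag -oppr_ge0 -sumrN sumr_ge0// => i _.
by rewrite -mulNr mulr_ge0 ?sqr_ge0// oppr_ge0.
Qed.

(** The positive part of [M t] stays positive for [s] slightly larger. A nonpositive subspace of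
    [M s] is therefore no larger than the nonpositive part of [M t], which is already counted at
    [t]. *)
Lemma index_count_right t : a <= t < b -> index_count t ->
  exists2 e, 0 < e & forall s, t < s < t + e -> index_count s.
Proof.
move=> /andP[a_t tb] tP.
have [P [d [Pu PM]]] := symmetric_diagonalization (Ms t).
have fP : row_free P by rewrite row_free_unit.
pose f i := 0 < d 0 i.
have Vf := row_free_rowsub (@spread_inj f) fP.
have := qform_gt0_near (Mc _) (spread_diag f PM).
case=> [||e /= e0 eP]; first by rewrite a_t ltW.
  by move=> i; rewrite mxE; exact: (spreadP i).
exists e => // s /andP[ts ste] m U fU Us.
have tse : `|t - s| < e by rewrite ltr0_norm ?subr_lt0// opprB ltrBlDl.
have mf := leq_dim_opposite fU Vf (fun x _ => Us x) (eP s tse).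
pose g i := ~~ f i.
have gE : (#|f| + #|g| = n)%N by rewrite -[RHS](card_ord n) -(cardC f).
have mg : (m <= #|g|)%N by rewrite -(leq_add2l #|f|) gE addnC; exact: mf.
apply: (@K_le _ t); first exact: ltW.
apply: (K_leq mg).
apply: tP; first exact: (row_free_rowsub (@spread_inj g) fP).
move=> x; rewrite -qform_mx (spread_diag g PM).
by apply: diag_le0 => i; rewrite mxE leNgt; exact: (spreadP i).
Qed.

(** Openness of positivity, applied to [- M] on the negative directions of [M t]. *)
Let negative_before t (P : 'M[R]_n) d : a < t <= b ->
  P *m M t *m P^T = diag_mx d ->
  let V := rowsub (@spread (fun i => d 0 i < 0)) P in
  exists2 s, a <= s < t & forall x, qform (M s) (x *m V) <= 0.
Proof.
move=> /andP[a_t tb] PM V.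
pose d' : 'rV_#|fun i => d 0 i < 0| := colsub (@spread (fun i => d 0 i < 0)) (- d).
have VM : V *m - M t *m V^T = diag_mx d'.
  rewrite mulmxN mulNmx (spread_diag (fun i => d 0 i < 0) PM).
  by apply/matrixP => i j; rewrite !mxE mulNrn.
have Mc' i j : {for t, continuous (fun s => (- M s) i j)}.
  rewrite (_ : (fun s => _) = (fun s => - M s i j)).
    by apply: cvgN; apply: Mc; rewrite tb ltW.
  by apply/funext => s; rewrite mxE.
have [|e /= e0 eP] := qform_gt0_near Mc' VM.
  by move=> i; rewrite !mxE oppr_gt0; exact: (spreadP i).
exists (Num.max a (t - e / 2)).
  by rewrite le_max lexx/= gt_max a_t ltrBlDr ltrDl divr_gt0.
move=> x; have [->|x0] := eqVneq x 0.
  by rewrite mul0mx /qform !mul0mx mxE.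
have := eP (Num.max a (t - e / 2)); rewrite /ball_/= => /(_ _ x x0).
rewrite /qform mulmxN mulNmx mxE oppr_gt0 => /(_ _)/ltW; apply.
have [h|h] := leP a (t - e / 2); first by rewrite subKr gtr0_norm; lra.
by rewrite gtr0_norm ?subr_gt0//; lra.
Qed.

(** The negative directions of [M t] are counted at some earlier [s] by the induction hypothesis,
    and the null directions form its kernel, which [K_ker] adds. Together they bound every
    nonpositive subspace. *)
Lemma index_count_left t : a < t <= b ->
  (forall s, a <= s < t -> index_count s) -> index_count t.
Proof.
move=> atb IH m U fU Us.
have [P [d [Pu PM]]] := symmetric_diagonalization (Ms t).
have fP : row_free P by rewrite row_free_unit.
pose f i := 0 < d 0 i; pose g i := d 0 i < 0; pose z i := d 0 i == 0.
have [s /andP[a_s st] sP] := negative_before atb PM.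
have Ks : K #|g| s.
  apply: IH sP; first by rewrite a_s.
  exact: (row_free_rowsub (@spread_inj g) fP).
have Kt : K (#|g| + #|z|) t.
  apply: (K_ker _ st (row_free_rowsub (@spread_inj z) fP)) => //.
    by case/andP: atb => /ltW-> ->.
  (* Cancelling [P^T] shows that the rows of [P] with zero diagonal entry are annihilated by [M t]
     itself, not merely isotropic. *)
  have PMt : P *m M t = diag_mx d *m invmx P^T.
    by rewrite -PM mulmxK// unitmx_tr.
  rewrite mul_rowsub_mx PMt; apply/matrixP => i j.
  rewrite mxE mul_diag_mx mxE [RHS]mxE.
  by rewrite (eqP (spreadP i)) mul0r.
apply: K_leq Kt.
have Vf := row_free_rowsub (@spread_inj f) fP.
have /(leq_dim_opposite fU Vf (fun x _ => Us x)) :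
    forall x, x != 0 -> 0 < qform (M t) (x *m rowsub (@spread f) P).
  move=> x x0; rewrite -qform_mx (spread_diag f PM).
  by apply: diag_gt0 x0 => i; rewrite mxE; exact: (spreadP i).
have : (n <= #|f| + (#|g| + #|z|))%N.
  rewrite -[leqLHS](card_ord n) -(cardC f) leq_add2l.
  rewrite -(cardUI g z) (leq_trans _ (leq_addr _ _))//.
  apply: subset_leq_card; apply/fintype.subsetP => i.
  by rewrite !inE -leNgt le_eqVlt orbC.
by move=> /(leq_trans _) h /h; rewrite addnC leq_add2l.
Qed.

Lemma count_of_nonpositive t : a <= t <= b -> index_count t.
Proof.
move=> /andP[a_t tb].
apply: (real_induction a_t) => [m U fU Us|s /andP[a_s st]|s /andP[a_s st]].
- have fM : row_free (1%:M : 'M[R]_n) by rewrite row_free_unit unitmx1.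
  have h : (m + n <= n)%N.
    apply: (leq_dim_opposite fU fM (fun x _ => Us x)) => x.
    by rewrite mulmx1; exact: Ma.
  by apply: (@K_leq 0) => //; rewrite -(leq_add2r n).
- by apply: index_count_right; rewrite a_s (lt_le_trans st).
- by apply: index_count_left; rewrite a_s (le_trans st).
Qed.

(** The negative directions of [M b] are nonpositive at some [s < b], so the count is already
    reached there. *)
Lemma count_of_negative m (U : 'M[R]_(m, n)) : a < b ->
  (forall x, x != 0 -> qform (M b) (x *m U) < 0) ->
  exists2 s, s < b & K m s.
Proof.
move=> a_b Us.
have fU : row_free U.
  apply: inj_row_free => x xU; apply: contraTeq isT => x0.
  by have := Us x x0; rewrite xU /qform !mul0mx mxE ltxx.
have [P [d [Pu PM]]] := symmetric_diagonalization (Ms b).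
have fP : row_free P by rewrite row_free_unit.
have [|s /andP[a_s sb] sP] := negative_before (t := b) _ PM.
  by rewrite a_b lexx.
exists s => //.
pose f i := 0 <= d 0 i; pose g i := d 0 i < 0.
have Vf := row_free_rowsub (@spread_inj f) fP.
have Ks : K #|g| s.
  apply: (count_of_nonpositive _ _ sP); first by rewrite a_s ltW.
  exact: (row_free_rowsub (@spread_inj g) fP).
apply: K_leq Ks.
suff : (m + #|f| <= n)%N.
  have gE : (#|f| + #|g| = n)%N.
    rewrite -[RHS](card_ord n) -(cardC f); congr addn.
    by apply: eq_card => i; rewrite !inE -ltNge.
  by move=> h; rewrite -(leq_add2l #|f|) addnC (leq_trans h)// -[leqLHS]gE.
rewrite addnC; apply: (leq_dim_opposite (M := - M b) Vf fU) => x x0.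
  rewrite /qform mulmxN mulNmx mxE oppr_le0 -/(qform (M b) _) -qform_mx.
  rewrite (spread_diag f PM) qform_diag sumr_ge0// => i _.
  by rewrite mulr_ge0 ?sqr_ge0// mxE; exact: (spreadP i).
by rewrite /qform mulmxN mulNmx mxE oppr_gt0; exact: Us.
Qed.

End Count.

End Crossing.

(** * The equation u'' = - l u *)

Section FundamentalSolutions.
Variable R : realType.
Implicit Types l x y : R.

Definition hcos y : R := (expR y + expR (- y)) / 2.
Definition hsin y : R := (expR y - expR (- y)) / 2.

(* [cosl l] and [sinl l] are the solutions of u'' = - l u with initial data
   (1, 0) and (0, 1).  Num.sqrt vanishes on negative numbers, so one of the two
   factors of [cosl l] is always 1. *)
Definition cosl l x : R := cos (Num.sqrt l * x) * hcos (Num.sqrt (- l) * x).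
Definition sinl l x : R :=
  if l == 0 then x
  else if 0 < l then sin (Num.sqrt l * x) / Num.sqrt l
  else hsin (Num.sqrt (- l) * x) / Num.sqrt (- l).

Lemma hcos0 : hcos 0 = 1.
Proof. by rewrite /hcos oppr0 expR0; field. Qed.

Lemma hsin0 : hsin 0 = 0.
Proof. by rewrite /hsin oppr0 subrr mul0r. Qed.

Lemma hcosN y : hcos (- y) = hcos y.
Proof. by rewrite /hcos opprK addrC. Qed.

Lemma hsinN y : hsin (- y) = - hsin y.
Proof. by rewrite /hsin opprK; field. Qed.

Lemma cosl_pos l x : 0 < l -> cosl l x = cos (Num.sqrt l * x).
Proof.
move=> l0; rewrite /cosl [Num.sqrt (- l)]ler0_sqrtr ?oppr_le0 1?ltW//.
by rewrite mul0r hcos0 mulr1.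
Qed.

Lemma cosl_neg l x : l < 0 -> cosl l x = hcos (Num.sqrt (- l) * x).
Proof.
by move=> l0; rewrite /cosl [Num.sqrt l]ler0_sqrtr ?ltW// mul0r cos0 mul1r.
Qed.

Lemma cosl_0 x : cosl 0 x = 1.
Proof. by rewrite /cosl oppr0 sqrtr0 mul0r cos0 hcos0 mulr1. Qed.

Lemma sinl_pos l x : 0 < l -> sinl l x = sin (Num.sqrt l * x) / Num.sqrt l.
Proof. by move=> l0; rewrite /sinl gt_eqF// l0. Qed.

Lemma sinl_neg l x : l < 0 ->
  sinl l x = hsin (Num.sqrt (- l) * x) / Num.sqrt (- l).
Proof. by move=> l0; rewrite /sinl lt_eqF// ltNge ltW. Qed.

Lemma sinl_0 x : sinl 0 x = x.
Proof. by rewrite /sinl eqxx. Qed.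

Lemma cosl0 l : cosl l 0 = 1.
Proof. by rewrite /cosl !mulr0 cos0 hcos0 mulr1. Qed.

Lemma sinl0 l : sinl l 0 = 0.
Proof. by rewrite /sinl !mulr0 sin0 hsin0 !mul0r !if_same. Qed.

Lemma coslN l x : cosl l (- x) = cosl l x.
Proof. by rewrite /cosl !mulrN cosN hcosN. Qed.

Lemma sinlN l x : sinl l (- x) = - sinl l x.
Proof.
by rewrite /sinl !mulrN sinN hsinN !mulNr; do 2?case: ifP.
Qed.

Global Instance is_derive_hcos y : is_derive y 1 hcos (hsin y).
Proof.
rewrite /hcos /hsin; apply: is_derive_eq.
by rewrite /GRing.scale/=; field.
Qed.

Global Instance is_derive_hsin y : is_derive y 1 hsin (hcos y).
Proof.
rewrite /hcos /hsin; apply: is_derive_eq.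
by rewrite /GRing.scale/=; field.
Qed.

Lemma is_derive_dilation (f : R -> R) df a x : is_derive (a * x) 1 f df ->
  is_derive x 1 (fun x => f (a * x)) (df * a).
Proof.
move=> fd.
have lin : is_derive x (1 : R) ( *%R a) a.
  by apply: is_derive_eq; rewrite /GRing.scale/= mulr1 .
exact: (@is_derive1_comp _ f ( *%R a) _ _ _ fd lin).
Qed.

Global Instance is_derive_cosl l x : is_derive x 1 (cosl l) (- (l * sinl l x)).
Proof.
have [l0|l0|->] := ltgtP l 0.
- rewrite (_ : cosl l = fun x => hcos (Num.sqrt (- l) * x)); last first.
    by apply/funext => y; exact: cosl_neg.
  apply: (is_derive_eq (is_derive_dilation (is_derive_hcos _))).
  have s0 : 0 < Num.sqrt (- l) by rewrite sqrtr_gt0 oppr_gt0.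
  have : Num.sqrt (- l) ^+ 2 = - l by rewrite sqr_sqrtr// oppr_ge0 ltW.
  rewrite sinl_neg//; move: (Num.sqrt (- l)) s0 => s s0 /(congr1 -%R).
  by rewrite opprK => <-; field; rewrite gt_eqF.
- rewrite (_ : cosl l = fun x => cos (Num.sqrt l * x)); last first.
    by apply/funext => y; exact: cosl_pos.
  apply: (is_derive_eq (is_derive_dilation (is_derive_cos _))).
  have s0 : 0 < Num.sqrt l by rewrite sqrtr_gt0.
  have : Num.sqrt l ^+ 2 = l by rewrite sqr_sqrtr// ltW.
  rewrite sinl_pos//; move: (Num.sqrt l) s0 => s s0 <-.
  by field; rewrite gt_eqF.
- rewrite (_ : cosl 0 = cst 1); last by apply/funext => y; exact: cosl_0.
  by apply: is_derive_eq; rewrite mul0r oppr0.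
Qed.

Global Instance is_derive_sinl l x : is_derive x 1 (sinl l) (cosl l x).
Proof.
have [l0|l0|->] := ltgtP l 0.
- rewrite (_ : sinl l = fun x => hsin (Num.sqrt (- l) * x) / Num.sqrt (- l)); last first.
    by apply/funext => y; exact: sinl_neg.
  have h := is_derive_dilation (is_derive_hsin (Num.sqrt (- l) * x)).
  apply: is_derive_eq; rewrite /GRing.scale/= cosl_neg//.
  by field; rewrite gt_eqF// sqrtr_gt0 oppr_gt0.
- rewrite (_ : sinl l = fun x => sin (Num.sqrt l * x) / Num.sqrt l); last first.
    by apply/funext => y; exact: sinl_pos.
  have h := is_derive_dilation (is_derive_sin (Num.sqrt l * x)).
  apply: is_derive_eq; rewrite /GRing.scale/= cosl_pos//.
  by field; rewrite gt_eqF// sqrtr_gt0.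
- rewrite (_ : sinl 0 = id); last by apply/funext => y; exact: sinl_0.
  by apply: is_derive_eq; rewrite cosl_0.
Qed.

(** This is the Wronskian of [cosl l] and [sinl l], and it unifies the circular and hyperbolic
    identities. *)
Lemma cosl2_sinl2 l x : cosl l x ^+ 2 + l * sinl l x ^+ 2 = 1.
Proof.
have d (z : R) : is_derive z (1 : R) (fun x => cosl l x ^+ 2 + l * sinl l x ^+ 2) 0.
  by apply: is_derive_eq; rewrite /GRing.scale/=; ring.
have := @is_derive_0_is_cst _ _ x 0 d.
by rewrite cosl0 sinl0 => ->; ring.
Qed.

(* Wronskians of solutions of the same equation are constant. *)
Lemma cosl_sinl_wronskian l x y :
  cosl l (x + y) * cosl l x + l * sinl l (x + y) * sinl l x = cosl l y /\
  sinl l (x + y) * cosl l x - cosl l (x + y) * sinl l x = sinl l y.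
Proof.
have dC (z : R) : is_derive z 1 (fun x => cosl l (x + y)) (- (l * sinl l (z + y))).
  have h : is_derive z (1 : R) (fun x : R => x + y) 1.
    by apply: is_derive_eq; rewrite addr0.
  have := @is_derive1_comp _ (cosl l) (fun x => x + y) z _ _ (is_derive_cosl l (z + y)) h.
  by rewrite mulr1.
have dS (z : R) : is_derive z 1 (fun x => sinl l (x + y)) (cosl l (z + y)).
  have h : is_derive z (1 : R) (fun x : R => x + y) 1.
    by apply: is_derive_eq; rewrite addr0.
  have := @is_derive1_comp _ (sinl l) (fun x => x + y) z _ _ (is_derive_sinl l (z + y)) h.
  by rewrite mulr1.
split.
  have d (z : R) : is_derive z (1 : R) (fun x => cosl l (x + y) * cosl l x +
      l * sinl l (x + y) * sinl l x) 0.
    by apply: is_derive_eq; rewrite /GRing.scale/=; ring.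
  have := @is_derive_0_is_cst _ _ x 0 d.
  by rewrite cosl0 sinl0 add0r => ->; ring.
have d (z : R) : is_derive z (1 : R) (fun x => sinl l (x + y) * cosl l x -
    cosl l (x + y) * sinl l x) 0.
  by apply: is_derive_eq; rewrite /GRing.scale/=; ring.
have := @is_derive_0_is_cst _ _ x 0 d.
by rewrite cosl0 sinl0 add0r => ->; ring.
Qed.

(** The two Wronskian identities are a linear system for the values at [x + y], with determinant 1
    by [cosl2_sinl2]. *)
Lemma coslD l x y :
  cosl l (x + y) = cosl l x * cosl l y - l * sinl l x * sinl l y.
Proof.
have [<- <-] := cosl_sinl_wronskian l x y.
rewrite -[LHS]mulr1 -(cosl2_sinl2 l x); ring.
Qed.

Lemma sinlD l x y :
  sinl l (x + y) = sinl l x * cosl l y + cosl l x * sinl l y.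
Proof.
have [<- <-] := cosl_sinl_wronskian l x y.
rewrite -[LHS]mulr1 -(cosl2_sinl2 l x); ring.
Qed.

(** For [l <= 0] the square root is 0 and the bound holds for every [x], so one condition covers all
    signs of [l]. *)
Lemma cosl_gt0 l x : Num.sqrt l * `|x| < pi / 2 -> 0 < cosl l x.
Proof.
move=> lx; rewrite mulr_gt0//; last first.
  by rewrite divr_gt0// addr_gt0// expR_gt0.
apply: cos_gt0_pihalf; rewrite -ltr_norml normrM ger0_norm//.
Qed.

Lemma sinl_gt0 l x : 0 < x -> Num.sqrt l * x < pi -> 0 < sinl l x.
Proof.
move=> x0; have [l0|l0|->] := ltgtP l 0; last by rewrite sinl_0.
- move=> _; have s0 : 0 < Num.sqrt (- l) by rewrite sqrtr_gt0 oppr_gt0.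
  rewrite sinl_neg// divr_gt0// divr_gt0// subr_gt0 ltr_expR.
  by rewrite (@lt_trans _ _ 0) ?oppr_lt0 ?mulr_gt0.
- have s0 : 0 < Num.sqrt l by rewrite sqrtr_gt0.
  move=> sx; rewrite sinl_pos// divr_gt0// sin_gt0_pi// sx mulr_gt0//.
Qed.

Lemma hcos_ge1 y : 1 <= hcos y.
Proof.
rewrite /hcos expRN; have e0 := expR_gt0 y; set e := expR y in e0 *.
rewrite ler_pdivlMr// mul1r -subr_ge0.
rewrite (_ : _ - _ = (e - 1) ^+ 2 / e); last by field; rewrite gt_eqF.
by rewrite divr_ge0 ?sqr_ge0 ?ltW.
Qed.

Lemma cosl_ge1 l x : l < 0 -> 1 <= cosl l x.
Proof. by move=> l0; rewrite cosl_neg// hcos_ge1. Qed.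

Lemma ler_sinl l x : l < 0 -> 0 <= x -> x <= sinl l x.
Proof.
move=> l0; rewrite le_eqVlt => /predU1P[<-|x0]; first by rewrite sinl0.
have [|c _] := @MVT R (sinl l) (cosl l) 0 x x0 (fun y _ => is_derive_sinl l y).
  apply: continuous_subspaceT => y; apply: differentiable_continuous.
  by apply/derivable1_diffP; apply: ex_derive.
by rewrite sinl0 !subr0 => ->; rewrite ler_peMl ?cosl_ge1// ltW.
Qed.

(* Bounds every quotient (cosl l h - 1) / sinl l h from below as l -> -oo. *)
Lemma cosl_sinl_coercive l (M h k : R) : 0 <= M -> 0 < h ->
  M + h^-1 <= k -> l = - k ^+ 2 -> 1 + M * sinl l h <= cosl l h.
Proof.
move=> M0 h0 Mk lE.
have k0 : 0 < k by rewrite (lt_le_trans _ Mk)// ltr_wpDl// invr_gt0.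
have l0 : l < 0 by rewrite lE oppr_lt0 exprn_gt0.
have hs := ler_sinl l0 (ltW h0).
have s0 : 0 <= sinl l h by apply: le_trans hs; exact: ltW.
(* On one side [sinl l h >= h] turns [h^-1 * sinl l h] into at least 1; on the other,
   [cosl^2 = 1 + k^2 sinl^2]. *)
apply: (@le_trans _ _ (k * sinl l h)).
  rewrite (le_trans _ (ler_wpM2r s0 Mk))// mulrDl addrC lerD2l.
  by rewrite -(mulVf (lt0r_neq0 h0)) ler_pM2l ?invr_gt0.
have c0 : 0 <= cosl l h by apply: le_trans (cosl_ge1 h l0).
have ks0 : 0 <= k * sinl l h by rewrite mulr_ge0// ltW.
rewrite -(ler_pXn2r (n := 2))//.
by have := cosl2_sinl2 l h; rewrite {2}lE exprMn; lra.
Qed.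

Lemma continuous_hcos : continuous hcos.
Proof.
move=> y; apply: differentiable_continuous; apply/derivable1_diffP.
exact: ex_derive.
Qed.

Lemma continuous_hsin : continuous hsin.
Proof.
move=> y; apply: differentiable_continuous; apply/derivable1_diffP.
exact: ex_derive.
Qed.

Lemma continuous_sqrt_dilation x : continuous (fun l => Num.sqrt l * x).
Proof.
by move=> l; apply: cvgM; [exact: sqrt_continuous | exact: cvg_cst].
Qed.

Lemma continuous_sqrtN_dilation x : continuous (fun l => Num.sqrt (- l) * x).
Proof.
move=> l; apply: (@continuous_comp _ _ _ -%R (fun l => Num.sqrt l * x)).
  exact: opp_continuous.
exact: continuous_sqrt_dilation.
Qed.

Lemma continuous_cosl x : continuous (fun l => cosl l x).
Proof.
move=> l; apply: cvgM.
  apply: (@continuous_comp _ _ _ (fun l => Num.sqrt l * x) cos).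
    exact: continuous_sqrt_dilation.
  exact: continuous_cos.
apply: (@continuous_comp _ _ _ (fun l => Num.sqrt (- l) * x) hcos).
  exact: continuous_sqrtN_dilation.
exact: continuous_hcos.
Qed.

Lemma ler_hcos x y : 0 <= x <= y -> hcos x <= hcos y.
Proof.
move=> /andP[x0 xy]; rewrite /hcos !expRN -subr_ge0.
have := expR_gt0 x; have := expR_gt0 y.
have : 1 <= expR x by rewrite -expR0 ler_expR.
have : expR x <= expR y by rewrite ler_expR.
move: (expR x) (expR y) => a b ab a1 b0 a0.
rewrite (_ : _ - _ = (b - a) * (1 - (a * b)^-1) / 2); last first.
  by field; rewrite !gt_eqF.
rewrite divr_ge0// mulr_ge0 ?subr_ge0// invf_le1 ?mulr_gt0//.
by rewrite -[leLHS]mulr1 ler_pM// (le_trans a1).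
Qed.

(** Gives continuity in [l] at 0, where the quotients defining [sinl] degenerate. By the mean value
    theorem [sinl l x] is [x * cosl l c] with [c] inside, and by monotonicity [cosl l c] is at least
    as close to 1 as [cosl l x]. *)
Lemma sinl_near0 l x : 0 < x -> Num.sqrt l * x <= pi ->
  `|sinl l x - x| <= x * `|cosl l x - 1|.
Proof.
move=> x0 lx.
have [|c /andP[c0 cx]] :=
  @MVT R (sinl l) (cosl l) 0 x x0 (fun y _ => is_derive_sinl l y).
  apply: continuous_subspaceT => y; apply: differentiable_continuous.
  by apply/derivable1_diffP; apply: ex_derive.
rewrite sinl0 !subr0 => ->.
have -> : cosl l c * x - x = x * (cosl l c - 1) by ring.
rewrite normrM gtr0_norm// ler_pM2l//.
have [l0|l0|->] := ltgtP l 0; last by rewrite !cosl_0.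
  rewrite !ger0_norm ?subr_ge0 ?cosl_ge1// lerD2r !cosl_neg//.
  by apply: ler_hcos; rewrite mulr_ge0 ?sqrtr_ge0 ?ler_wpM2l ?sqrtr_ge0// ltW.
rewrite !ler0_norm ?subr_le0 ?cosl_pos ?cos_le1// !opprB lerD2l lerN2.
have s0 : 0 < Num.sqrt l by rewrite sqrtr_gt0.
have sc : Num.sqrt l * c < Num.sqrt l * x by rewrite ltr_pM2l.
have sc0 : 0 <= Num.sqrt l * c by rewrite mulr_ge0// ltW.
apply/ltW; rewrite ltr_cos// !in_itv/=.
  by rewrite sc0 (le_trans _ lx)// ltW.
by rewrite lx (le_trans sc0)// ltW.
Qed.

Lemma continuous_sinl x : 0 < x -> continuous (fun l => sinl l x).
Proof.
move=> x0 l; have [l0|l0|->] := ltgtP l 0.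
- have s0 : Num.sqrt (- l) != 0 by rewrite gt_eqF// sqrtr_gt0 oppr_gt0.
  have c : {for l, continuous
      (fun l => hsin (Num.sqrt (- l) * x) / Num.sqrt (- l))}.
    apply: cvgM.
      apply: (@continuous_comp _ _ _ (fun l => Num.sqrt (- l) * x) hsin).
        exact: continuous_sqrtN_dilation.
      exact: continuous_hsin.
    apply: cvgV => //.
    apply: (@continuous_comp _ _ _ -%R Num.sqrt); first exact: opp_continuous.
    exact: sqrt_continuous.
  rewrite /continuous_at sinl_neg//; apply: cvg_trans c; apply: near_eq_cvg.
  by near=> s; rewrite sinl_neg//; near: s; exact: lt_nbhsl.
- have s0 : Num.sqrt l != 0 by rewrite gt_eqF// sqrtr_gt0.
  have c : {for l, continuous (fun l => sin (Num.sqrt l * x) / Num.sqrt l)}.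
    apply: cvgM.
      apply: (@continuous_comp _ _ _ (fun l => Num.sqrt l * x) sin).
        exact: continuous_sqrt_dilation.
      exact: continuous_sin.
    by apply: cvgV => //; exact: sqrt_continuous.
  rewrite /continuous_at sinl_pos//; apply: cvg_trans c; apply: near_eq_cvg.
  by near=> s; rewrite sinl_pos//; near: s; exact: lt_nbhsr.
- rewrite /continuous_at sinl_0; apply/cvgrPdistC_le => e e0.
  have /cvgrPdistC_le /(_ _ (divr_gt0 e0 x0)) c := @continuous_cosl x 0.
  have /cvgrPdistC_lt /(_ _ (pi_gt0 R)) d := @continuous_sqrt_dilation x 0.
  near=> s; apply: (@le_trans _ _ (x * `|cosl s x - 1|)).
    apply: sinl_near0 => //; apply: le_trans (ler_norm _) (ltW _).
    by near: s; move: d; apply: filterS => s; rewrite sqrtr0 mul0r subr0.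
  rewrite mulrC -ler_pdivlMr//; near: s; move: c; apply: filterS => s.
  by rewrite cosl_0.
Unshelve. all: by end_near. Qed.

End FundamentalSolutions.

(** * Integrals on [0, l] *)

Section Primitives.
Variable R : realType.
Implicit Types (f g : R -> R) (a b l : R).
Local Notation leb := (@lebesgue_measure R).

Lemma is_derive1_continuous f (df x : R) : is_derive x 1 f df -> {for x, continuous f}.
Proof.
move=> fd; apply: differentiable_continuous; apply/derivable1_diffP.
exact: ex_derive.
Qed.

Lemma is_derive1_within f (df : R -> R) a b :
  (forall x, a <= x <= b -> is_derive x 1 f (df x)) ->
  {within `[a, b], continuous f}.
Proof.
move=> fd; apply: derivable_within_continuous => x; rewrite in_itv/= => xab.
by apply: ex_derive; exact: fd.
Qed.

Lemma derive_ge0_le f (df : R -> R) a b : a <= b ->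
  (forall x, a <= x <= b -> is_derive x 1 f (df x)) ->
  (forall x, a <= x <= b -> 0 <= df x) -> f a <= f b.
Proof.
move=> ab fd df0.
have [||c] := @MVT_segment _ f df _ _ ab.
- by move=> x; rewrite in_itv/= => /andP[ax xb]; apply: fd; rewrite !ltW.
- exact: is_derive1_within fd.
rewrite in_itv/= => cab fE; rewrite -subr_ge0 fE.
by rewrite mulr_ge0 ?subr_ge0// df0.
Qed.

Definition integral_to l f : R := \int[leb]_(x in `[0, l]) f x.

Lemma continuous_integrable a b f : continuous f ->
  leb.-integrable `[a, b] (EFin \o f).
Proof.
move=> cf; apply: continuous_compact_integrable; first exact: segment_compact.
exact: continuous_subspaceT.
Qed.

Lemma integral_to_primitive l f F : 0 < l -> continuous f ->
  (forall x, 0 <= x <= l -> is_derive x 1 F (f x)) ->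
  integral_to l f = F l - F 0.
Proof.
move=> l0 cf Fd.
have Fc := is_derive1_within Fd.
have /(continuous_within_itvP _ l0)[_ F0 Fl] := Fc.
rewrite /integral_to /Rintegral (continuous_FTC2 l0 (F := F))//.
- exact: continuous_subspaceT.
- split=> // x; rewrite in_itv/= => /andP[x0 xl].
  by apply: ex_derive; apply: Fd; rewrite !ltW.
- move=> x; rewrite in_itv/= => /andP[x0 xl]; rewrite derive1E.
  by apply: derive_val; apply: Fd; rewrite !ltW.
Qed.

Lemma ex_primitive l f : 0 < l -> continuous f ->
  exists F, forall x, 0 <= x <= l -> is_derive x 1 F (f x).
Proof.
move=> l0 cf; exists (fun x => \int[leb]_(t in `[- 1, x]) f t).
move=> x /andP[x0 xl].
have xl1 : x < l + 1 by rewrite (le_lt_trans xl)// ltrDl.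
have x1 : - 1 < x by rewrite (lt_le_trans _ x0)// oppr_lt0.
have [dF F'] := continuous_FTC1_closed xl1 (@continuous_integrable (- 1) _ f cf) x1 (cf x).
by rewrite -F' derive1E; exact: derivableP.
Qed.

Lemma integral_toD l f g : 0 < l -> continuous f -> continuous g ->
  integral_to l (fun x => f x + g x) = integral_to l f + integral_to l g.
Proof.
by move=> l0 cf cg; rewrite [LHS]RintegralD//; exact: continuous_integrable.
Qed.

Lemma integral_toZ l f a : continuous f ->
  integral_to l (fun x => a * f x) = a * integral_to l f.
Proof.
by move=> cf; rewrite [LHS]RintegralZl//; exact: continuous_integrable.
Qed.

Lemma integral_to_sum l n (c : 'I_n -> R) (f : 'I_n -> R -> R) : 0 < l ->
  (forall i, continuous (f i)) ->
  integral_to l (fun x => \sum_i c i * f i x) = \sum_i c i * integral_to l (f i).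
Proof.
move=> l0 cf.
have cs (s : seq 'I_n) : continuous (fun x => \sum_(i <- s) c i * f i x) /\
    integral_to l (fun x => \sum_(i <- s) c i * f i x) =
    \sum_(i <- s) c i * integral_to l (f i).
  elim: s => [|i s [cs IH]].
    split; first by under eq_fun do rewrite big_nil; move=> x; exact: cvg_cst.
    rewrite big_nil -[RHS](mul0r (integral_to l (fun=> 0))) -integral_toZ.
      by rewrite /integral_to; apply: eq_Rintegral => x _; rewrite big_nil mul0r.
    by move=> x; exact: cvg_cst.
  have ci : continuous (fun x => c i * f i x).
    by move=> x; apply: cvgM; [exact: cvg_cst | exact: cf].
  have sE : (fun x => \sum_(j <- i :: s) c j * f j x) =
      (fun x => c i * f i x + \sum_(j <- s) c j * f j x).
    by apply/funext => x; rewrite big_cons.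
  split; first by rewrite sE => x; apply: cvgD; [exact: ci | exact: cs].
  by rewrite sE integral_toD// IH big_cons integral_toZ.
exact: (cs _).2.
Qed.

Lemma integral_to_ge0 l f : (forall x, 0 <= x <= l -> 0 <= f x) ->
  0 <= integral_to l f.
Proof. by move=> f0; apply: Rintegral_ge0 => x /=; rewrite in_itv/=; exact: f0. Qed.

(** A primitive is nondecreasing with equal end values, hence constant, so [f] vanishes inside;
    continuity covers the two ends. *)
Lemma integral_to_eq0 l f : 0 < l -> continuous f -> (forall x, 0 <= f x) ->
  integral_to l f = 0 -> forall x, 0 <= x <= l -> f x = 0.
Proof.
move=> l0 cf f0 If.
have [F Fd] := ex_primitive l0 cf.
have Fc x : 0 <= x <= l -> F x = F 0.
  move=> /andP[x0 xl]; apply: le_anti; apply/andP; split.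
    rewrite (_ : F 0 = F l); last first.
      by apply/eqP; rewrite eq_sym -subr_eq0 -(integral_to_primitive l0 cf Fd) If.
    apply: (derive_ge0_le (df := f)) => // y /andP[xy yl]; apply: Fd.
    by rewrite yl (le_trans x0).
  apply: (derive_ge0_le (df := f)) => // y /andP[y0 yx]; apply: Fd.
  by rewrite y0 (le_trans yx).
have foo x : 0 < x < l -> f x = 0.
  move=> /andP[x0 xl]; have xx : 0 <= x <= l by rewrite !ltW.
  rewrite -(@derive_val _ _ _ _ _ _ _ (Fd x xx)).
  rewrite -(@derive_val _ _ _ _ _ _ _ (is_derive_cst (F 0) x 1)).
  apply: near_eq_derive.
  near=> y; apply: Fc; apply/andP; split; apply: ltW.
    by near: y; exact: lt_nbhsr.
  by near: y; exact: lt_nbhsl.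
move=> x /andP[x0 xl].
apply: contrapT => /eqP fx.
have fx0 : 0 < f x by rewrite lt_def fx f0.
have : \forall y \near x, 0 < f y.
  by have /cvgr_gt/(_ _ fx0) := cf x.
move=> fnear; suff [y yl fy] : exists2 y, 0 < y < l & 0 < f y.
  by rewrite foo ?ltxx in fy.
have [xl'|xl'] := ltP x l.
  near x^'+ => y; exists y.
    apply/andP; split; last by near: y; exact: nbhs_right_lt.
    by rewrite (le_lt_trans x0)//; near: y; exact: nbhs_right_gt.
  by near: y; rewrite near_withinE; apply: filterS fnear.
have xE : x = l by apply: le_anti; rewrite xl.
near x^'- => y; exists y.
  apply/andP; split; last by rewrite (lt_le_trans _ xl)//; near: y; exact: nbhs_left_lt.
  by near: y; apply: nbhs_left_gt; rewrite xE.
by near: y; rewrite near_withinE; apply: filterS fnear.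
Unshelve. all: by end_near. Qed.

End Primitives.

(** * Weak and classical solutions on an edge *)

Section Solutions.
Variable R : realType.
Implicit Types (l mu A B x y : R) (f g : R -> R).
Local Notation leb := (@lebesgue_measure R).

Definition sol l A B x : R := A * cosl l x + B * sinl l x.
Definition dsol l A B x : R := B * cosl l x - l * A * sinl l x.

Global Instance is_derive_sol l A B x :
  is_derive x 1 (sol l A B) (dsol l A B x).
Proof. by apply: is_derive_eq; rewrite /GRing.scale/= /dsol; ring. Qed.

Global Instance is_derive_dsol l A B x :
  is_derive x 1 (dsol l A B) (- (l * sol l A B x)).
Proof. by apply: is_derive_eq; rewrite /GRing.scale/= /sol; ring. Qed.

Lemma continuous_sol l A B : continuous (sol l A B).
Proof. by move=> x; apply: is_derive1_continuous. Qed.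

Lemma continuous_dsol l A B : continuous (dsol l A B).
Proof. by move=> x; apply: is_derive1_continuous. Qed.

Lemma sol0 l A B : sol l A B 0 = A.
Proof. by rewrite /sol cosl0 sinl0; ring. Qed.

Lemma dsol0 l A B : dsol l A B 0 = B.
Proof. by rewrite /dsol cosl0 sinl0; ring. Qed.

Lemma solD l A B x y :
  sol l A B (x + y) = sol l A B x * cosl l y + dsol l A B x * sinl l y.
Proof. by rewrite /sol /dsol coslD sinlD; ring. Qed.

Lemma L2_on_continuous l g : continuous g -> L2_on l g.
Proof.
move=> cg; split; first by apply: measurable_funTS; exact: continuous_measurable_fun.
apply: (@continuous_integrable _ _ _ (fun x => g x ^+ 2)).
by move=> x; apply: cvgM; exact: cg.
Qed.

Lemma H1_on_primitive l f (df : R -> R) : (forall x, is_derive x 1 f (df x)) ->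
  continuous df -> H1_on l f df.
Proof.
move=> fd cd; split; first exact: L2_on_continuous.
move=> x /andP[]; rewrite le_eqVlt => /predU1P[<- _|x0 _].
  by rewrite set_itv1 Rintegral_set1 addr0.
have -> : \int[leb]_(t in `[0, x]) df t = f x - f 0.
  by apply: integral_to_primitive => // y _; exact: fd.
by rewrite addrC subrK.
Qed.

Lemma H2_on_sol l mu A B f : (forall x, 0 <= x <= l -> f x = sol mu A B x) ->
  0 <= l -> H2_on l f (dsol mu A B) (fun x => - (mu * sol mu A B x)).
Proof.
move=> fE l0.
have c2 : continuous (fun x => - (mu * sol mu A B x)).
  move=> x; apply: cvgN; apply: cvgM; first exact: cvg_cst.
  exact: continuous_sol.
have [L2 fI] : H1_on l (sol mu A B) (dsol mu A B).
  by apply: H1_on_primitive => //; exact: continuous_dsol.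
split; last exact: H1_on_primitive.
split=> // x xl; rewrite !fE ?lexx//.
exact: fI.
Qed.

(** Domination by [1 + g ^+ 2], which is integrable on a bounded interval. *)
Lemma L2_on_integrable l g : L2_on l g -> leb.-integrable `[0, l] (EFin \o g).
Proof.
move=> [mg ig].
apply: (@le_integrable _ _ _ leb _ _ _ (fun x => (1 + g x ^+ 2)%:E)) => //.
- exact/measurable_EFinP.
- move=> x _ /=; rewrite lee_fin.
  rewrite [leRHS]ger0_norm; last by rewrite addr_ge0 ?sqr_ge0.
  rewrite -(real_normK (num_real (g x))).
  by have := sqr_ge0 (`|g x| - 1); have := normr_ge0 (g x); lra.
- have i1 : leb.-integrable `[0, l] (EFin \o fun=> 1).
    by apply: continuous_integrable => x; exact: cvg_cst.
  exact: (integrableD _ i1 ig).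
Qed.

Lemma derive0_const g a l : (forall x, a < x < l -> is_derive x 1 g 0) ->
  {within `[a, l], continuous g} -> forall x, a <= x <= l -> g x = g a.
Proof.
move=> gd gc x /andP[ax xl].
have [||c _] := @MVT_segment _ g (fun=> 0) a x ax.
- move=> y; rewrite in_itv/= => /andP[ay yx]; apply: gd.
  by rewrite ay (lt_le_trans yx).
- by apply: continuous_subspaceW gc; apply: subset_itvl; rewrite bnd_simp.
- by rewrite mul0r => /subr0_eq.
Qed.

Lemma eq_within_derive f g (df x a l : R) : a < x < l ->
  (forall y, a < y < l -> f y = g y) -> is_derive x 1 f df -> is_derive x 1 g df.
Proof.
move=> /andP[ax xl] fg fd; apply: near_eq_is_derive fd.
near=> y; rewrite fg//; apply/andP; split.
  by near: y; exact: lt_nbhsr.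
by near: y; exact: lt_nbhsl.
Unshelve. all: by end_near. Qed.

Lemma within_at f a l x : a < x < l -> {within `[a, l], continuous f} ->
  {for x, continuous f}.
Proof.
move=> /andP[ax xl] cf; have al := lt_trans ax xl.
have /(continuous_within_itvP _ al)[fc _ _] := cf.
by apply: fc; rewrite in_itv/= ax.
Qed.

Lemma H1_on_within l f f' : 0 < l -> H1_on l f f' ->
  {within `[0, l], continuous f}.
Proof.
move=> l0 [L2 fI].
pose P x := f 0 + \int[leb]_(t in `[0, x]) f' t.
have cP : {within `[0, l], continuous P}.
  move=> x; apply: cvgD; first exact: cvg_cst.
  exact: (parameterized_integral_continuous (ltW l0) (L2_on_integrable L2)).
apply: subspace_eq_continuous cP => x.
by rewrite inE/= in_itv/= => xl; rewrite [RHS]fI.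
Qed.

Lemma H1_on_derive l f f' : 0 < l -> H1_on l f f' ->
  {within `[0, l], continuous f'} ->
  forall x, 0 < x < l -> is_derive x 1 f (f' x).
Proof.
move=> l0 [L2 fI] cf' x xl.
pose P y := \int[leb]_(t in `[0, y]) f' t.
apply: (@eq_within_derive (fun y => f 0 + P y) _ _ _ 0 l) => //.
  by move=> y /andP[y0 yl]; rewrite [RHS]fI// !ltW.
have [x0 xl'] := andP xl.
have [dP P'] := continuous_FTC1_closed xl' (L2_on_integrable L2) x0 (within_at xl cf').
have dP' : is_derive x 1 P (f' x) by rewrite -P' derive1E; exact: derivableP.
by have := is_deriveD (is_derive_cst (f 0) x 1) dP'; rewrite add0r.
Qed.

(* The equation is integrated once, so that f' satisfies an integral equation
   with a continuous integrand and the two invariants below are classically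
   differentiable inside the interval. *)
Lemma sol_of_H2_on l mu f f' f'' : 0 < l -> H2_on l f f' f'' ->
  {ae leb, forall x, 0 <= x <= l -> mu * f x = - f'' x} ->
  exists A B, forall x, 0 <= x <= l ->
    f x = sol mu A B x /\ f' x = dsol mu A B x.
Proof.
move=> l0 [H1f H1f'] ae.
have cf := H1_on_within l0 H1f; have cf' := H1_on_within l0 H1f'.
have df : forall x, 0 < x < l -> is_derive x 1 f (f' x) := H1_on_derive l0 H1f cf'.
have cmf : {within `[0, l], continuous (fun x => - (mu * f x))}.
  by move=> x; apply: cvgN; apply: cvgM; [exact: cvg_cst | exact: cf].
(* The equation holds almost everywhere, so under the integral [f''] may be replaced by a continuous
   function. *)
have H1f'' : H1_on l f' (fun x => - (mu * f x)).
  split.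
    split; first exact: subspace_continuous_measurable_fun.
    apply: continuous_compact_integrable; first exact: segment_compact.
    by move=> x; apply: cvgM; exact: cmf.
  move=> x /andP[x0 xl]; rewrite H1f'.2 ?x0//; congr (_ + _).
  rewrite /Rintegral; congr fine; apply: ae_eq_integral => //.
  - apply/measurable_EFinP; apply: measurable_funS H1f'.1.1 => //.
    by apply: subset_itvl; rewrite bnd_simp.
  - apply/measurable_EFinP.
    apply: (@measurable_funS _ _ _ _ `[0, l]) => //.
      by apply: subset_itvl; rewrite bnd_simp.
    exact: subspace_continuous_measurable_fun.
  - move: ae; apply: (@filterS _ _ (ae_filter_ringOfSetsType leb)) => y ae /=.
    rewrite in_itv/= => /andP[y0 yx].
    by rewrite ae ?opprK// y0 (le_trans yx).
have df' : forall x, 0 < x < l -> is_derive x 1 f' (- (mu * f x)).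
  exact: H1_on_derive l0 H1f'' cmf.
have cC : {within `[0, l], continuous (cosl mu)}.
  by apply: continuous_subspaceT => x; exact: is_derive1_continuous.
have cS : {within `[0, l], continuous (sinl mu)}.
  by apply: continuous_subspaceT => x; exact: is_derive1_continuous.
(* Transports the pair [(f, f')] back to 0: on a solution, [a] and [b] are its initial value and
   slope. *)
pose a x := f x * cosl mu x - f' x * sinl mu x.
pose b x := f' x * cosl mu x + mu * f x * sinl mu x.
have da x : 0 < x < l -> is_derive x 1 a 0.
  move=> xl; have fd := df x xl; have fd' := df' x xl.
  by apply: is_derive_eq; rewrite /GRing.scale/=; ring.
have db x : 0 < x < l -> is_derive x 1 b 0.
  move=> xl; have fd := df x xl; have fd' := df' x xl.
  by apply: is_derive_eq; rewrite /GRing.scale/=; ring.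
have ca : {within `[0, l], continuous a}.
  by move=> x; apply: cvgB; apply: cvgM; [exact: cf | exact: cC | exact: cf' | exact: cS].
have cb : {within `[0, l], continuous b}.
  move=> x; apply: cvgD; apply: cvgM; try by [exact: cf' | exact: cC | exact: cS].
  by apply: cvgM; [exact: cvg_cst | exact: cf].
exists (f 0), (f' 0) => x xl.
have aE : f x * cosl mu x - f' x * sinl mu x = f 0.
  by have := derive0_const da ca xl; rewrite /a cosl0 sinl0 => ->; ring.
have bE : f' x * cosl mu x + mu * f x * sinl mu x = f' 0.
  by have := derive0_const db cb xl; rewrite /b cosl0 sinl0 => ->; ring.
rewrite /sol /dsol -aE -bE; split.
  by rewrite -[LHS]mulr1 -(cosl2_sinl2 mu x); ring.
by rewrite -[LHS]mulr1 -(cosl2_sinl2 mu x); ring.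
Qed.

End Solutions.

(** * Minimal energy on a segment *)

Section Segments.
Variable R : realType.
Implicit Types (l a h p q x : R) (f g dg E : R -> R).

Lemma is_derive_shift f (df a x : R) : is_derive (x - a) 1 f df ->
  is_derive x 1 (fun x => f (x - a)) df.
Proof.
move=> fd; have d : is_derive x (1 : R) (fun x : R => x - a) 1.
  by apply: is_derive_eq; rewrite subr0.
by have := @is_derive1_comp _ f (fun x => x - a) x _ _ fd d; rewrite mulr1.
Qed.

(* Dirichlet energy minus [l] times the square norm, for the solution on an
   interval of length [h] with end values [p] and [q]. *)
Definition segment_form l h p q : R :=
  (cosl l h * (p ^+ 2 + q ^+ 2) - 2 * p * q) / sinl l h.

(* Jacobi's argument: with f the solution of the same end values and u a
   positive solution, (E - f f' - 2 f' (g - f) - (g - f)^2 u' / u)' is the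
   square of (g - f)' - (g - f) u' / u. *)
Lemma segment_min l a h g dg E : 0 < h -> Num.sqrt l * h < pi ->
  (forall x, is_derive x 1 g (dg x)) ->
  (forall x, a <= x <= a + h -> is_derive x 1 E (dg x ^+ 2 - l * g x ^+ 2)) ->
  segment_form l h (g a) (g (a + h)) <= E (a + h) - E a.
Proof.
move=> h0 lh gd Ed.
have S0 : 0 < sinl l h by exact: sinl_gt0.
pose B := (g (a + h) - cosl l h * g a) / sinl l h.
pose f x := sol l (g a) B (x - a); pose df x := dsol l (g a) B (x - a).
(* Centring [u] at the midpoint makes it positive on the whole segment as soon as
   [Num.sqrt l * h < pi], since only distances up to [h / 2] occur. *)
pose c := a + h / 2.
pose u x := cosl l (x - c); pose v x := sinl l (x - c).
pose F x := E x - f x * df x - 2 * df x * (g x - f x) +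
  (g x - f x) ^+ 2 * (l * v x / u x).
pose dF x := (dg x - df x + (g x - f x) * (l * v x / u x)) ^+ 2.
have u0 x : a <= x <= a + h -> 0 < u x.
  move=> /andP[ax xh]; apply: cosl_gt0.
  rewrite (@le_lt_trans _ _ (Num.sqrt l * (h / 2)))//; last by lra.
  by rewrite ler_wpM2l ?sqrtr_ge0// ler_norml /c; lra.
have fd x : is_derive x 1 f (df x) by exact: is_derive_shift.
have dfd x : is_derive x 1 df (- (l * f x)) by exact: is_derive_shift.
have ud x : is_derive x 1 u (- (l * v x)) by exact: is_derive_shift.
have vd x : is_derive x 1 v (u x) by exact: is_derive_shift.
have FdF x : a <= x <= a + h -> is_derive x 1 F (dF x).
  move=> xh; have Edx := Ed x xh; have u0x := u0 x xh.
  have un0 : u x != 0 by rewrite gt_eqF.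
  apply: is_derive_eq; rewrite /GRing.scale/= /dF.
  by field.
have : F a <= F (a + h).
  apply: (derive_ge0_le (df := dF)) => //; first by rewrite lerDl ltW.
  by move=> x _; exact: sqr_ge0.
rewrite /F.
have -> : f a = g a by rewrite /f subrr sol0.
have -> : f (a + h) = g (a + h).
  by rewrite /f addrAC subrr add0r /sol /B; field; rewrite gt_eqF.
have -> : df a = B by rewrite /df subrr dsol0.
rewrite !subrr !mulr0 !subr0 !expr0n/= !mul0r !addr0.
rewrite /df addrAC subrr add0r => FE.
suff segE : segment_form l h (g a) (g (a + h)) =
    g (a + h) * dsol l (g a) B h - g a * B by rewrite segE; lra.
rewrite /segment_form /dsol /B.
apply: (mulIf (lt0r_neq0 S0)); rewrite divfK ?gt_eqF//.
transitivity (cosl l h * g (a + h) ^+ 2 - g a * g (a + h) *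
    (cosl l h ^+ 2 + l * sinl l h ^+ 2) + (cosl l h * g a ^+ 2 - g a * g (a + h))).
  by rewrite cosl2_sinl2; ring.
by field; rewrite gt_eqF.
Qed.

Lemma edge_min l h n g dg : (0 < n)%N -> 0 < h -> Num.sqrt l * h < pi ->
  (forall x, is_derive x 1 g (dg x)) -> continuous dg ->
  \sum_(j < n) segment_form l h (g (j%:R * h)) (g (j.+1%:R * h)) <=
  integral_to (n%:R * h) (fun x => dg x ^+ 2 - l * g x ^+ 2).
Proof.
move=> n0 h0 lh gd cdg.
have L0 : 0 < n%:R * h by rewrite mulr_gt0// ltr0n.
have cE : continuous (fun x => dg x ^+ 2 - l * g x ^+ 2).
  have cg : continuous g by move=> x; exact: is_derive1_continuous (gd x).
  move=> x; apply: cvgB; first by apply: cvgM; exact: cdg.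
  by apply: cvgM; [exact: cvg_cst | apply: cvgM; exact: cg].
have [E Ed] := ex_primitive L0 cE.
rewrite (integral_to_primitive L0 cE Ed) -[in leRHS](mul0r h).
rewrite -(telescope_sumr (fun j => E (j%:R * h)) (leq0n n)) big_mkord.
apply: ler_sum => j _; rewrite -natr1 mulrDl mul1r.
apply: (segment_min (dg := dg)) => // x /andP[xl xu]; apply: Ed.
rewrite (le_trans _ xl) ?mulr_ge0 ?(ltW h0)//= (le_trans xu)//.
by rewrite -[X in _ + X]mul1r -mulrDl natr1 ler_pM2r// ler_nat.
Qed.

End Segments.

(** * The quadratic form of a metric graph *)

Section WeakForm.
Variables (R : realType) (G : metric_graph R).
Implicit Types (f g df dg : edge G -> R -> R) (c : vertex G -> R) (mu nu : R).

Definition incident (v : vertex G) : bool :=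
  [exists e : edge G, exists b, edge_end G e b == v].

(* If no edge is incident with [v], then [c v] is only constrained not to
   contribute to [energy]: the value there is not determined by the function. *)
Definition test_function f df c : Prop :=
  [/\ forall e (x : R), is_derive x 1 (f e) (df e x),
      forall e, continuous (df e),
      forall e b, end_value f e b = c (edge_end G e b),
      forall v, strength G v = +oo%E -> c v = 0
    & forall v, ~~ incident v -> fine (strength G v) * c v = 0].

Definition inner f g : R := \sum_(e : edge G) integral_to (len G e) (fun x => f e x * g e x).

Definition energy mu f df c : R :=
  \sum_(e : edge G) integral_to (len G e) (fun x => df e x ^+ 2 - mu * f e x ^+ 2) +
  \sum_(v : vertex G) fine (strength G v) * c v ^+ 2.

(** An eigenfunction encoded by its value and slope at the start of every edge. The last clause
    normalises the vertex value where no edge determines it. *)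
Definition eigen_data nu (A B : edge G -> R) c : Prop :=
  [/\ forall e b, end_value (fun e => sol nu (A e) (B e)) e b = c (edge_end G e b),
      forall v, if strength G v is g%:E then
          \sum_(e : edge G) \sum_(b : bool | edge_end G e b == v)
            end_deriv (fun e => dsol nu (A e) (B e)) e b + g * c v = 0
        else c v = 0
    & forall v, ~~ incident v -> c v = 0].

Lemma eigenspace_data nu f : Defs.eigenspace nu f ->
  exists A B c, eigen_data nu A B c /\
    forall e x, 0 <= x <= len G e -> f e x = sol nu (A e) (B e) x.
Proof.
move=> [f' [f'' [fH fae fv]]].
have /choice[AB fE] e : exists AB : R * R, forall x, 0 <= x <= len G e ->
    f e x = sol nu AB.1 AB.2 x /\ f' e x = dsol nu AB.1 AB.2 x.
  have [A [B h]] := sol_of_H2_on (len_gt0 e) (fH e) (fae e).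
  by exists (A, B).
have /choice[c0 c0P] := fv.
pose A e := (AB e).1; pose B e := (AB e).2.
have len0 e : 0 <= len G e by rewrite ltW// len_gt0.
have fE1 e x : 0 <= x <= len G e -> f e x = sol nu (A e) (B e) x.
  by move=> xe; exact: (fE e x xe).1.
have fE2 e x : 0 <= x <= len G e -> f' e x = dsol nu (A e) (B e) x.
  by move=> xe; exact: (fE e x xe).2.
have endE e b : end_value (fun e => sol nu (A e) (B e)) e b = end_value f e b.
  by rewrite /end_value fE1//; case: b; rewrite ?lexx ?len0.
have derivE e b : end_deriv (fun e => dsol nu (A e) (B e)) e b = end_deriv f' e b.
  by rewrite /end_deriv; case: b; rewrite fE2// lexx len0.
exists A, B, (fun v => if incident v then c0 v else 0); split; last exact: fE1.
split=> [e b|v|v /negbTE->//].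
  rewrite endE; have [/(_ _ _ erefl) -> _] := c0P (edge_end G e b).
  by case: ifPn => // /existsP[]; exists e; apply/existsP; exists b.
have [_] := c0P v.
under [X in _ -> match _ with EFin r => X + _ = 0 | _ => _ end]eq_bigr => e _.
  under eq_bigr => b _ do rewrite derivE.
  over.
case: ifPn => // iv.
case: (strength G v) => // g _.
rewrite mulr0 addr0 big1// => e _; rewrite big1// => b /eqP eb.
by case/existsP: iv; exists e; apply/existsP; exists b; apply/eqP.
Qed.

Lemma eigen_data_eigenspace nu A B c f : eigen_data nu A B c ->
  (forall e x, 0 <= x <= len G e -> f e x = sol nu (A e) (B e) x) ->
  Defs.eigenspace nu f.
Proof.
move=> [AB1 AB2 AB3] fE.
have len0 e : 0 <= len G e by rewrite ltW// len_gt0.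
exists (fun e => dsol nu (A e) (B e)), (fun e x => - (nu * sol nu (A e) (B e) x)).
split=> [e|e|v].
- by apply: H2_on_sol => // x; exact: fE.
- by apply: aeW => x xe; rewrite opprK fE.
- exists (c v); split; last exact: AB2.
  move=> e b <-; rewrite -AB1 /end_value fE//.
  by case: b; rewrite ?lexx ?len0.
Qed.

Lemma eigen_data_test_function nu A B c : eigen_data nu A B c ->
  test_function (fun e => sol nu (A e) (B e)) (fun e => dsol nu (A e) (B e)) c.
Proof.
move=> [AB1 AB2 AB3]; split=> //.
- by move=> e x; exact: is_derive_sol.
- by move=> e; exact: continuous_dsol.
- by move=> v vD; have := AB2 v; rewrite vD.
- by move=> v /AB3 ->; rewrite mulr0.
Qed.

Lemma sum_edge_ends (F : edge G -> bool -> R) c :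
  \sum_(e : edge G) \sum_(b : bool) F e b * c (edge_end G e b) =
  \sum_(v : vertex G) (\sum_(e : edge G) \sum_(b : bool | edge_end G e b == v) F e b) * c v.
Proof.
under [RHS]eq_bigr => v _ do rewrite mulr_suml.
rewrite [RHS]exchange_big/=; apply: eq_bigr => e _.
under [RHS]eq_bigr => v _ do rewrite mulr_suml big_mkcond/=.
rewrite [RHS]exchange_big/=; apply: eq_bigr => b _.
rewrite (bigD1 (edge_end G e b))//= eqxx big1 ?addr0// => v vb.
by rewrite eq_sym (negbTE vb).
Qed.

Lemma test_function_continuous g dg c : test_function g dg c ->
  forall e, continuous (g e).
Proof. by move=> [gd _ _ _ _] e x; exact: is_derive1_continuous (gd e x). Qed.

(** Integration by parts on every edge; the boundary terms, regrouped by vertices, are converted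
    into strengths by the vertex conditions. *)
Lemma green nu A B c g dg cg : eigen_data nu A B c -> test_function g dg cg ->
  inner (fun e => dsol nu (A e) (B e)) dg +
    \sum_(v : vertex G) fine (strength G v) * c v * cg v =
  nu * inner (fun e => sol nu (A e) (B e)) g.
Proof.
move=> AB gT; have cg_ := test_function_continuous gT.
have [AB1 AB2 AB3] := AB; have [gd cdg gc gD _] := gT.
pose F e b := end_deriv (fun e => dsol nu (A e) (B e)) e b.
have edgeE e : integral_to (len G e) (fun x => dsol nu (A e) (B e) x * dg e x) =
    nu * integral_to (len G e) (fun x => sol nu (A e) (B e) x * g e x) +
    \sum_(b : bool) F e b * cg (edge_end G e b).
  have c1 : continuous (fun x => dsol nu (A e) (B e) x * dg e x).
    by move=> x; apply: cvgM; [exact: continuous_dsol | exact: cdg].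
  have c2 : continuous (fun x => sol nu (A e) (B e) x * g e x).
    by move=> x; apply: cvgM; [exact: continuous_sol | exact: cg_].
  have c3 : continuous (fun x => - nu * (sol nu (A e) (B e) x * g e x)).
    by move=> x; apply: cvgM; [exact: cvg_cst | exact: c2].
  have d (x : R) : is_derive x 1 (fun x => dsol nu (A e) (B e) x * g e x)
      (dsol nu (A e) (B e) x * dg e x + - nu * (sol nu (A e) (B e) x * g e x)).
    have gdx := gd e x.
    by apply: is_derive_eq; rewrite /GRing.scale/=; ring.
  have c4 : continuous (fun x => dsol nu (A e) (B e) x * dg e x +
      - nu * (sol nu (A e) (B e) x * g e x)).
    by move=> x; apply: cvgD; [exact: c1 | exact: c3].
  have := integral_to_primitive (len_gt0 e) c4 (fun x _ => d x).
  rewrite integral_toD ?len_gt0// integral_toZ// mulNr => /eqP.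
  rewrite subr_eq addrC => /eqP ->; congr (_ + _).
  rewrite big_bool/= -!gc /F /end_deriv /end_value; ring.
rewrite /inner; under eq_bigr => e _ do rewrite edgeE.
rewrite big_split/= -mulr_sumr sum_edge_ends -addrA -big_split/=.
rewrite [X in _ + X]big1 ?addr0//.
move=> v _; have := AB2 v.
case sv: (strength G v) => [r||] /=.
- by rewrite -mulrDl => ->; rewrite mul0r.
(* At a Dirichlet vertex the flux is uncontrolled, but the test function vanishes. *)
- by move=> _; rewrite gD// !mulr0 addr0.
- by move: (strength_neqNy v); rewrite sv.
Qed.

Lemma innerC f g : inner f g = inner g f.
Proof.
by apply: eq_bigr => e _; apply: eq_Rintegral => x _; rewrite mulrC.
Qed.

(** The left side of [green] is symmetric, so using it with both orders of the pair multiplies the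
    inner product by two different eigenvalues. *)
Lemma eigen_orthogonal nu A B c nu' A' B' c' : nu != nu' ->
  eigen_data nu A B c -> eigen_data nu' A' B' c' ->
  inner (fun e => sol nu (A e) (B e)) (fun e => sol nu' (A' e) (B' e)) = 0.
Proof.
move=> nn' AB AB'.
have h1 := green AB (eigen_data_test_function AB').
have h2 := green AB' (eigen_data_test_function AB).
have h : (nu - nu') * inner (fun e => sol nu (A e) (B e))
    (fun e => sol nu' (A' e) (B' e)) = 0.
  rewrite mulrBl -h1 [in nu' * _]innerC -h2 [in X in _ - (X + _)]innerC.
  rewrite (_ : \sum_v fine (strength G v) * c' v * c v =
    \sum_v fine (strength G v) * c v * c' v) ?subrr//.
  by apply: eq_bigr => v _; ring.
by move/eqP: h; rewrite mulf_eq0 subr_eq0 (negbTE nn') => /eqP.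
Qed.

Lemma inner_ge0 f : 0 <= inner f f.
Proof.
by apply: sumr_ge0 => e _; apply: integral_to_ge0 => x _; rewrite -expr2 sqr_ge0.
Qed.

Lemma inner_eq0 f : (forall e, continuous (f e)) -> inner f f = 0 ->
  forall e x, 0 <= x <= len G e -> f e x = 0.
Proof.
move=> cf /eqP; rewrite psumr_eq0 => [/allP f0|e _]; last first.
  by apply: integral_to_ge0 => x _; rewrite -expr2 sqr_ge0.
move=> e x xe; apply/eqP; rewrite -[X in is_true X]orbb -mulf_eq0; apply/eqP.
have /eqP fe0 := f0 e (mem_index_enum e).
apply: (integral_to_eq0 (len_gt0 e) _ _ fe0) => //.
  by move=> y; apply: cvgM; exact: cf.
by move=> y; rewrite -expr2 sqr_ge0.
Qed.

End WeakForm.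

(** * Finite families of eigenfunctions *)

Section Families.
Variables (R : realType) (G : metric_graph R).
Implicit Types (mu t : R).

Definition comb n T (x : 'rV[R]_n) (F : 'I_n -> T -> R -> R) (e : T) (s : R) : R :=
  \sum_i x 0 i * F i e s.

Definition vcomb n T (x : 'rV[R]_n) (c : 'I_n -> T -> R) (v : T) : R :=
  \sum_i x 0 i * c i v.

Definition lin_free n (F : 'I_n -> edge G -> R -> R) : Prop :=
  forall x, (forall e s, 0 <= s <= len G e -> comb x F e s = 0) -> x = 0.

Lemma comb_linear n T a x y (F : 'I_n -> T -> R -> R) e s :
  comb (a *: x + y) F e s = a * comb x F e s + comb y F e s.
Proof.
rewrite /comb mulr_sumr -big_split/=; apply: eq_bigr => i _.
by rewrite !mxE; ring.
Qed.

Lemma vcomb_linear n T a x y (c : 'I_n -> T -> R) v :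
  vcomb (a *: x + y) c v = a * vcomb x c v + vcomb y c v.
Proof.
rewrite /vcomb mulr_sumr -big_split/=; apply: eq_bigr => i _.
by rewrite !mxE; ring.
Qed.

Lemma continuous_comb n T x (F : 'I_n -> T -> R -> R) e :
  (forall i, continuous (F i e)) -> continuous (comb x F e).
Proof.
move=> cF s; apply: cvg_big => [|i _]; first exact: add_continuous.
by apply: cvgM; [exact: cvg_cst | exact: cF].
Qed.

Lemma is_derive_comb n T x (F dF : 'I_n -> T -> R -> R) e (s : R) :
  (forall i, is_derive s 1 (F i e) (dF i e s)) ->
  is_derive s 1 (comb x F e) (comb x dF e s).
Proof.
move=> Fd; rewrite (_ : comb x F e = \sum_i (fun s => x 0 i * F i e s)); last first.
  by apply/funext => y; rewrite fct_sumE.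
exact: is_derive_sum.
Qed.

Lemma test_function_comb n x (F dF : 'I_n -> edge G -> R -> R) c :
  (forall i, test_function (F i) (dF i) (c i)) ->
  test_function (comb x F) (comb x dF) (vcomb x c).
Proof.
move=> T; split.
- by move=> e s; apply: is_derive_comb => i; have [] := T i.
- by move=> e; apply: continuous_comb => i; have [] := T i.
- move=> e b; rewrite /end_value /comb /vcomb; apply: eq_bigr => i _.
  by have [_ _ <-] := T i.
- move=> v vD; rewrite /vcomb big1// => i _.
  by have [_ _ _ ->] := T i; rewrite // mulr0.
- move=> v iv; rewrite /vcomb mulr_sumr big1// => i _.
  by have [_ _ _ _ h] := T i; rewrite mulrCA h// mulr0.
Qed.

Lemma inner_comb n x (F : 'I_n -> edge G -> R -> R) g :
  (forall i e, continuous (F i e)) -> (forall e, continuous (g e)) ->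
  inner (comb x F) g = \sum_i x 0 i * inner (F i) g.
Proof.
move=> cF cg; under [RHS]eq_bigr do rewrite mulr_sumr.
rewrite exchange_big/=; apply: eq_bigr => e _.
rewrite -(integral_to_sum (fun i => x 0 i) (len_gt0 e)).
  apply: eq_Rintegral => s _; rewrite mulr_suml.
  by apply: eq_bigr => i _; rewrite mulrA.
by move=> i s; apply: cvgM; [exact: cF | exact: cg].
Qed.

Lemma energyE mu f df (c : vertex G -> R) : (forall e, continuous (f e)) ->
  (forall e, continuous (df e)) ->
  energy mu f df c = inner df df - mu * inner f f +
    \sum_(v : vertex G) fine (strength G v) * c v ^+ 2.
Proof.
move=> cf cdf; congr (_ + _).
rewrite /inner mulr_sumr -sumrB; apply: eq_bigr => e _.
have c1 : continuous (fun x => df e x * df e x) by move=> x; apply: cvgM; exact: cdf.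
have c2 : continuous (fun x => f e x * f e x) by move=> x; apply: cvgM; exact: cf.
rewrite -mulNr -integral_toZ// -integral_toD ?len_gt0//.
  by apply: eq_Rintegral => x _; rewrite !expr2 mulNr.
by move=> x; apply: cvgM; [exact: cvg_cst | exact: c2].
Qed.

Section EigenFamily.
Variables (n : nat) (nu : 'I_n -> R) (A B : 'I_n -> edge G -> R).
Variable c : 'I_n -> vertex G -> R.
Hypothesis AB : forall i, eigen_data (nu i) (A i) (B i) (c i).

Definition fam_sol i e := sol (nu i) (A i e) (B i e).
Definition fam_dsol i e := dsol (nu i) (A i e) (B i e).

Lemma continuous_fam_sol i e : continuous (fam_sol i e).
Proof. exact: continuous_sol. Qed.

Lemma continuous_fam_dsol i e : continuous (fam_dsol i e).
Proof. exact: continuous_dsol. Qed.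

Lemma fam_test_function x :
  test_function (comb x fam_sol) (comb x fam_dsol) (vcomb x c).
Proof.
by apply: test_function_comb => i; exact: eigen_data_test_function (AB i).
Qed.

(** Coordinates of the square root of mu minus the Laplacian, applied to the combination [x].
    Coordinates with [nu i = mu] are lost, which is what the strict cases have to repair. *)
Definition damp mu (x : 'rV[R]_n) : 'rV[R]_n :=
  \row_i (x 0 i * Num.sqrt (mu - nu i)).

(* Eigenfunctions for different eigenvalues are orthogonal, so the coefficient
   (nu i - mu) x_i x_j of each surviving inner product splits as a product. *)
Lemma fam_energy mu x : (forall i, nu i <= mu) ->
  energy mu (comb x fam_sol) (comb x fam_dsol) (vcomb x c) =
  - inner (comb (damp mu x) fam_sol) (comb (damp mu x) fam_sol).
Proof.
move=> numu; set g := comb x fam_sol; set dg := comb x fam_dsol.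
have cg e : continuous (g e).
  by apply: continuous_comb => i; exact: continuous_fam_sol.
have cdg e : continuous (dg e).
  by apply: continuous_comb => i; exact: continuous_fam_dsol.
rewrite energyE//.
have -> : inner dg dg = \sum_i x 0 i * inner (fam_dsol i) dg.
  by rewrite inner_comb// => i e; exact: continuous_fam_dsol.
have innerE y z : inner (comb y fam_sol) (comb z fam_sol) =
    \sum_i \sum_j y 0 i * z 0 j * inner (fam_sol i) (fam_sol j).
  rewrite inner_comb; [|exact: continuous_fam_sol|]; last first.
    by move=> e; apply: continuous_comb => i; exact: continuous_fam_sol.
  apply: eq_bigr => i _; rewrite innerC inner_comb//; last 2 first.
  - exact: continuous_fam_sol.
  - exact: continuous_fam_sol.
  by rewrite mulr_sumr; apply: eq_bigr => j _; rewrite innerC mulrA.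
have -> : \sum_v fine (strength G v) * vcomb x c v ^+ 2 =
    \sum_i x 0 i * \sum_v fine (strength G v) * c i v * vcomb x c v.
  under [RHS]eq_bigr do rewrite mulr_sumr.
  rewrite exchange_big/=; apply: eq_bigr => v _.
  rewrite expr2 {1}/vcomb mulrA mulr_sumr mulr_suml.
  by apply: eq_bigr => i _; ring.
rewrite addrAC -big_split/=.
under eq_bigr do rewrite -mulrDr (green (AB _) (fam_test_function x)).
rewrite [X in mu * X]innerE innerE mulr_sumr -sumrB -sumrN.
apply: eq_bigr => i _; rewrite innerC inner_comb; last 2 first.
- exact: continuous_fam_sol.
- exact: continuous_fam_sol.
rewrite !mulr_sumr -sumrB -sumrN; apply: eq_bigr => j _.
rewrite innerC !mxE.
have [nuij|nuij] := eqVneq (nu i) (nu j); last first.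
  by rewrite /fam_sol (eigen_orthogonal nuij (AB i) (AB j)) !mulr0 subrr oppr0.
have : Num.sqrt (mu - nu i) ^+ 2 = mu - nu i by rewrite sqr_sqrtr// subr_ge0.
rewrite -nuij; set s := Num.sqrt _; set I := inner _ _ => sE.
have -> : nu i = mu - s ^+ 2 by rewrite sE subKr.
by ring.
Qed.

End EigenFamily.

Lemma fam_inner_eq0 n nu A B (x : 'rV[R]_n) :
  inner (comb x (fam_sol nu A B)) (comb x (fam_sol nu A B)) = 0 ->
  lin_free (fam_sol nu A B) -> x = 0.
Proof.
move=> /inner_eq0 h; apply; apply: h => e.
by apply: continuous_comb => i; exact: continuous_fam_sol.
Qed.

Lemma below_family n mu : eigenvalues_below G n mu ->
  exists nu A B c, [/\ forall i, nu i <= mu,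
    forall i, eigen_data (nu i) (A i) (B i) (c i) &
    lin_free (fam_sol nu A B : 'I_n -> _)].
Proof.
move=> [nu [f [numu fE ff]]].
have /choice[ABc ABcP] i : exists ABc : (edge G -> R) * (edge G -> R) * (vertex G -> R),
    eigen_data (nu i) ABc.1.1 ABc.1.2 ABc.2 /\
    forall e x, 0 <= x <= len G e -> f i e x = sol (nu i) (ABc.1.1 e) (ABc.1.2 e) x.
  by have [/eigenspace_data[A [B [c h]]] _] := fE i; exists (A, B, c).
exists nu, (fun i => (ABc i).1.1), (fun i => (ABc i).1.2), (fun i => (ABc i).2).
split=> // [i|x x0]; first exact: (ABcP i).1.
apply/rowP => i; rewrite mxE; apply: ff i => e s es.
rewrite -[RHS](x0 e s es); apply: eq_bigr => i _.
by rewrite (ABcP i).2.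
Qed.

Lemma family_below n mu nu A B c : (forall i, nu i <= mu) ->
  (forall i, eigen_data (nu i) (A i) (B i) (c i)) ->
  lin_free (fam_sol nu A B : 'I_n -> _) -> eigenvalues_below G n mu.
Proof.
move=> numu AB ff; exists nu, (fam_sol nu A B); split=> //.
  move=> i; split; first exact: eigen_data_eigenspace (AB i) _.
  apply: contrapT => f0; have /rowP/(_ i) : 'e_i = 0 :> 'rV[R]_n.
    apply: ff => e s es; rewrite /comb (bigD1 i)//= big1 => [|j ji].
      rewrite addr0; have [->|fi] := eqVneq (fam_sol nu A B i e s) 0.
        by rewrite mulr0.
      by exfalso; apply: f0; exists e, s.
    by rewrite !mxE (negbTE ji) andbF mul0r.
  by rewrite !mxE !eqxx => /eqP; rewrite oner_eq0.
move=> a a0 i; have /rowP/(_ i) : \row_j a j = 0 :> 'rV[R]_n.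
  by apply: ff => e s es; rewrite -[RHS](a0 e s es); apply: eq_bigr => j _; rewrite mxE.
by rewrite !mxE.
Qed.

Definition cat_fun T n m (a : 'I_n -> T) (b : 'I_m -> T) (i : 'I_(n + m)) : T :=
  match fintype.split i with inl i => a i | inr i => b i end.

Lemma cat_funl T n m (a : 'I_n -> T) (b : 'I_m -> T) i :
  cat_fun a b (lshift m i) = a i.
Proof.
by rewrite /cat_fun; case: split_ordP => [j /lshift_inj->|j /eqP]//; rewrite eq_lrshift.
Qed.

Lemma cat_funr T n m (a : 'I_n -> T) (b : 'I_m -> T) i :
  cat_fun a b (rshift n i) = b i.
Proof.
by rewrite /cat_fun; case: split_ordP => [j /eqP|j /rshift_inj->]//; rewrite eq_rlshift.
Qed.

(** In a vanishing combination the part at [t] is minus the part below [t]. The two are orthogonal,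
    so the part at [t] has norm 0. *)
Lemma lin_free_cat n m t nu A B c nu' A' B' c' :
  (forall i, nu i < t) -> (forall i, nu' i = t) ->
  (forall i, eigen_data (nu i) (A i) (B i) (c i)) ->
  (forall i, eigen_data (nu' i) (A' i) (B' i) (c' i)) ->
  lin_free (fam_sol nu A B : 'I_n -> _) ->
  lin_free (fam_sol nu' A' B' : 'I_m -> _) ->
  lin_free (fam_sol (cat_fun nu nu') (cat_fun A A') (cat_fun B B')).
Proof.
move=> nut nut' AB AB' ff ff' x x0.
set F := fam_sol nu A B in ff *; set F' := fam_sol nu' A' B' in ff' *.
have {}x0 e s : 0 <= s <= len G e -> comb (lsubmx x) F e s = - comb (rsubmx x) F' e s.
  move=> es; apply/eqP; rewrite -addr_eq0 -[eqbRHS](x0 e s es) /comb big_split_ord/=.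
  apply/eqP; congr (_ + _); apply: eq_bigr => i _.
    by rewrite mxE /fam_sol !cat_funl.
  by rewrite mxE /fam_sol !cat_funr.
have FF'0 : inner (comb (lsubmx x) F) (comb (rsubmx x) F') = 0.
  rewrite inner_comb; [|by move=> i e; exact: continuous_fam_sol|]; last first.
    by move=> e; apply: continuous_comb => i; exact: continuous_fam_sol.
  rewrite big1// => i _; rewrite innerC inner_comb; last 2 first.
  - by move=> j e; exact: continuous_fam_sol.
  - by move=> e; exact: continuous_fam_sol.
  rewrite big1 ?mulr0// => j _; rewrite (eigen_orthogonal _ (AB' j) (AB i)) ?mulr0//.
  by rewrite nut' gt_eqF.
have r0 : rsubmx x = 0.
  apply: (fam_inner_eq0 (nu := nu') (A := A') (B := B')) => //.
  rewrite -[LHS]opprK -[RHS]oppr0 -[in RHS]FF'0; congr (- _).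
  rewrite /inner -sumrN; apply: eq_bigr => e _.
  rewrite -[in LHS]mulN1r -integral_toZ.
    apply: eq_Rintegral => s /[1!inE]/=; rewrite in_itv/= => es.
    by rewrite x0// mulN1r mulNr.
  have cF : continuous (comb (rsubmx x) F' e).
    by apply: continuous_comb => i; exact: continuous_fam_sol.
  by move=> s; apply: cvgM; exact: cF.
have l0 : lsubmx x = 0.
  apply: ff => e s es; rewrite x0// r0 /comb big1 ?oppr0// => i _.
  by rewrite mxE mul0r.
by rewrite -(hsubmxK x) l0 r0 row_mx0.
Qed.

End Families.

(** * The form on nodal values *)

Lemma linear_for_sum (R : realType) k p (L : 'rV[R]_k -> R) : linear_for *%R L ->
  forall (a : 'I_p -> R) (u : 'I_p -> 'rV[R]_k),
  L (\sum_i a i *: u i) = \sum_i a i * L (u i).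
Proof.
move=> Ll a u; have L0 : L 0 = 0.
  by have := Ll (-1) 0 0; rewrite scaler0 addr0 mulN1r addNr.
elim: (index_enum _) => [|i s IH]; first by rewrite !big_nil L0.
by rewrite !big_cons Ll IH.
Qed.

Section Discretisation.
Variables (R : realType) (G : metric_graph R) (m : nat).
Implicit Types (l t mu : R) (e : edge G) (v : vertex G).

(* Every edge is cut into [m.+1] segments of length [mesh e]; the unknowns are
   the values at the vertices and at the [m] interior nodes of every edge. *)
Definition mesh e : R := len G e / m.+1%:R.

Lemma mesh_gt0 e : 0 < mesh e.
Proof. by rewrite divr_gt0 ?len_gt0. Qed.

Lemma mesh_len e : m.+1%:R * mesh e = len G e.
Proof. by rewrite mulrC divfK// pnatr_eq0. Qed.

Definition unknown : finType := (vertex G + edge G * 'I_m)%type.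

Local Notation "''V'" := 'rV[R]_#|unknown| (at level 8).
Implicit Types (y z : 'V).

Definition nodal y (i : unknown) : R := y 0 (enum_rank i).

Definition free_vertex v : bool := (strength G v != +oo%E) && incident v.

Definition vertex_value y v : R := if free_vertex v then nodal y (inl v) else 0.

(** Nodes 0 and [m.+1] are the end vertices of the edge; for [j <= m.+1], [insub] fails only at the
    latter. *)
Definition node y e (j : nat) : R :=
  if j is k.+1 then
    if insub k is Some i then nodal y (inr (e, i))
    else vertex_value y (edge_end G e true)
  else vertex_value y (edge_end G e false).
Arguments node : simpl never.

Definition segment_bilin l (h p q r s : R) : R :=
  (cosl l h * (p * r + q * s) - p * s - q * r) / sinl l h.

Lemma segment_bilinE l h p q : segment_bilin l h p q p q = segment_form l h p q.
Proof. by rewrite /segment_bilin /segment_form; congr (_ / _); ring. Qed.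

(* Dirichlet and isolated vertices carry no value; the strength 1 forces their
   coordinates to vanish on the kernel of the form. *)
Definition node_strength v : R :=
  if free_vertex v then fine (strength G v) else 1.

Definition node_form l y z : R :=
  \sum_e \sum_(j < m.+1) segment_bilin l (mesh e)
    (node y e j) (node y e j.+1) (node z e j) (node z e j.+1) +
  \sum_v node_strength v * nodal y (inl v) * nodal z (inl v).

Definition node_mx l : 'M[R]_#|unknown| :=
  \matrix_(i, j) node_form l 'e_i 'e_j.

Lemma nodal_linear i : linear_for *%R (nodal ^~ i).
Proof. by move=> a y z; rewrite /nodal !mxE. Qed.

Lemma vertex_value_linear v : linear_for *%R (vertex_value ^~ v).
Proof.
move=> a y z; rewrite /vertex_value; case: ifP => _; first exact: nodal_linear.
by rewrite mulr0 addr0.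
Qed.

Lemma node_linear e j : linear_for *%R (fun y => node y e j).
Proof.
move=> a y z; rewrite /node; case: j => [|k]; first exact: vertex_value_linear.
by case: insub => [i|]; [exact: nodal_linear | exact: vertex_value_linear].
Qed.

Lemma node_form_linearl l z : linear_for *%R (fun y => node_form l y z).
Proof.
move=> a y y'; rewrite /node_form mulrDr !mulr_sumr addrACA -!big_split/=.
congr (_ + _); last by apply: eq_bigr => v _; rewrite nodal_linear/=; ring.
apply: eq_bigr => e _.
rewrite mulr_sumr -big_split/=; apply: eq_bigr => j _.
by rewrite !node_linear /segment_bilin; ring.
Qed.

Lemma node_formC l y z : node_form l y z = node_form l z y.
Proof.
congr (_ + _); last by apply: eq_bigr => v _; ring.
by apply: eq_bigr => e _; apply: eq_bigr => j _; congr (_ / _); ring.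
Qed.

Lemma node_mxE l y z : (y *m node_mx l *m z^T) 0 0 = node_form l y z.
Proof.
rewrite [in RHS](row_sum_delta y) (linear_for_sum (@node_form_linearl l z)).
rewrite !mxE.
under eq_bigr do rewrite !mxE mulr_suml.
rewrite exchange_big/=; apply: eq_bigr => i _.
rewrite node_formC [in RHS](row_sum_delta z).
rewrite (linear_for_sum (@node_form_linearl l _)) mulr_sumr.
by apply: eq_bigr => j _; rewrite mxE node_formC; ring.
Qed.

Lemma qform_node_mx l y : qform (node_mx l) y = node_form l y y.
Proof. exact: node_mxE. Qed.

Lemma node_mx_sym l : (node_mx l)^T = node_mx l.
Proof. by apply/matrixP => i j; rewrite !mxE node_formC. Qed.

Lemma continuous_node_mx l i j : (forall e, sinl l (mesh e) != 0) ->
  {for l, continuous (fun t => node_mx t i j)}.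
Proof.
move=> S0; rewrite (_ : (fun t => node_mx t i j) =
  fun t => node_form t 'e_i 'e_j); last by apply/funext => t; rewrite mxE.
apply: cvgD; last exact: cvg_cst.
apply: cvg_big => [|e _]; first exact: add_continuous.
apply: cvg_big => [|k _]; first exact: add_continuous.
apply: cvgM; last by apply: cvgV => //; exact: continuous_sinl (mesh_gt0 e) l.
apply: cvgB; last exact: cvg_cst.
apply: cvgB; last exact: cvg_cst.
by apply: cvgM; [exact: continuous_cosl | exact: cvg_cst].
Qed.

Lemma node_interior y e (k : 'I_m) : node y e k.+1 = nodal y (inr (e, k)).
Proof. by rewrite /node valK. Qed.

Lemma node_last y e : node y e m.+1 = vertex_value y (edge_end G e true).
Proof. by rewrite /node insubF// ltnn. Qed.

Lemma nodal_free y v : free_vertex v ->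
  exists e j, (j <= m.+1)%N /\ nodal y (inl v) = node y e j.
Proof.
move=> fv; have /andP[_ /existsP[e /existsP[b /eqP eb]]] := fv.
exists e, (if b then m.+1 else 0%N); split; first by case: b eb.
by case: b eb => eb; rewrite ?node_last /node /vertex_value eb fv.
Qed.

Lemma node_eq0 y : (forall e j, (j <= m.+1)%N -> node y e j = 0) ->
  (forall v, ~~ free_vertex v -> nodal y (inl v) = 0) -> y = 0.
Proof.
move=> n0 v0; apply/rowP => i; rewrite mxE -(enum_valK i) -/(nodal y _).
case: (enum_val i) => [v|[e k]]; last first.
  by rewrite -node_interior n0// ltnS ltnW.
have [fv|/v0//] := boolP (free_vertex v).
by have [e [j [jm ->]]] := nodal_free y fv; exact: n0.
Qed.

(** * Kernel vectors as nodal values of eigenfunctions *)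

Section Kernel.
Variables (t : R) (y : 'V).
Hypothesis S0 : forall e, sinl t (mesh e) != 0.
Hypothesis y_ker : forall z, node_form t y z = 0.

(** For the solution interpolating nodes [j] and [j.+1], these are its derivatives at the right and
    left end of that segment. *)
Definition flux_right e j : R :=
  (cosl t (mesh e) * node y e j.+1 - node y e j) / sinl t (mesh e).
Definition flux_left e j : R :=
  (node y e j.+1 - cosl t (mesh e) * node y e j) / sinl t (mesh e).

Lemma node_form_flux z : node_form t y z =
  \sum_e \sum_(j < m.+1) (flux_right e j * node z e j.+1 - flux_left e j * node z e j) +
  \sum_v node_strength v * nodal y (inl v) * nodal z (inl v).
Proof.
congr (_ + _); apply: eq_bigr => e _; apply: eq_bigr => j _.
by rewrite /segment_bilin /flux_right /flux_left; ring.
Qed.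

Lemma nodal_delta i i' : nodal 'e_(enum_rank i) i' = (i' == i)%:R.
Proof. by rewrite /nodal !mxE/= (inj_eq enum_rank_inj). Qed.

Lemma vertex_value_delta_inr k v : vertex_value 'e_(enum_rank (inr k : unknown)) v = 0.
Proof. by rewrite /vertex_value nodal_delta; case: ifP. Qed.

(** Testing against the unit vector of an interior node leaves only its two adjacent segments: the
    interpolant has no kink there. *)
Lemma flux_match e (k : 'I_m) : flux_right e k = flux_left e k.+1.
Proof.
have := y_ker 'e_(enum_rank (inr (e, k) : unknown)).
rewrite node_form_flux [X in _ + X]big1 ?addr0; last first.
  by move=> v _; rewrite nodal_delta mulr0.
have nodeE e' j : (j <= m.+1)%N ->
    node 'e_(enum_rank (inr (e, k) : unknown)) e' j = ((e' == e) && (j == k.+1))%:R.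
  case: j => [_|j jm]; first by rewrite /node vertex_value_delta_inr andbF.
  move: jm; rewrite ltnS leq_eqVlt => /predU1P[->|jm].
    by rewrite node_last vertex_value_delta_inr eqSS gtn_eqF ?andbF.
  by rewrite (node_interior _ _ (Ordinal jm)) nodal_delta.
rewrite (bigD1 e)//= [X in _ + X]big1 ?addr0 => [|e' ee']; last first.
  rewrite big1// => j _; rewrite !nodeE ?(negbTE ee') ?mulr0 ?subrr//.
  exact: ltnW.
rewrite sumrB => /eqP; rewrite subr_eq0 => /eqP.
rewrite (bigD1 (widen_ord (leqnSn m) k))//= big1 ?addr0 => [|j jk]; last first.
  rewrite nodeE// eqxx eqSS/= (_ : (j == k :> nat) = false) ?mulr0//.
  by apply: contraNF jk => /eqP jk; apply/eqP/val_inj.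
rewrite nodeE ?ltnS 1?ltnW// !eqxx mulr1 => ->.
have km : (k.+1 < m.+1)%N := ltn_ord k.
rewrite (bigD1 (Ordinal km))//= big1 ?addr0 => [|j jk].
  by rewrite nodeE 1?ltnW// !eqxx mulr1.
rewrite nodeE; last exact: ltnW.
rewrite eqxx/= (_ : (j == k.+1 :> nat) = false) ?mulr0//.
by apply: contraNF jk => /eqP jk; apply/eqP/val_inj.
Qed.

(** The unit vector of [v] tests the vertex condition; summing over both ends of an edge counts a
    loop twice. *)
Lemma flux_balance v : free_vertex v ->
  \sum_e \sum_(b | edge_end G e b == v)
    (if b then flux_right e m else - flux_left e 0) +
  fine (strength G v) * vertex_value y v = 0.
Proof.
move=> fv; have := y_ker 'e_(enum_rank (inl v : unknown)).
rewrite node_form_flux => h; rewrite -[RHS]h; congr (_ + _); last first.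
  rewrite (bigD1 v)//= big1 ?addr0 => [|v' vv'].
    by rewrite nodal_delta eqxx mulr1 /node_strength /vertex_value fv.
  by rewrite nodal_delta (_ : (_ == _) = false) ?mulr0//; exact: negbTE.
apply: eq_bigr => e _.
have vvE v' : vertex_value 'e_(enum_rank (inl v : unknown)) v' = (v' == v)%:R.
  rewrite /vertex_value nodal_delta; case: ifPn => // fv'.
  by case: eqP fv' => // ->; rewrite fv.
have nodeE (k : 'I_m) : node 'e_(enum_rank (inl v : unknown)) e k.+1 = 0.
  by rewrite node_interior nodal_delta.
rewrite sumrB [X in X - _]big_ord_recr/= node_last vvE.
rewrite [X in X + _ - _]big1 ?add0r => [|j _]; last by rewrite nodeE mulr0.
rewrite big_ord_recl/= [node _ _ 0]vvE.
rewrite [X in _ - (_ + X)]big1 ?addr0 => [|j _]; last by rewrite nodeE mulr0.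
rewrite big_mkcond big_bool/= !mulr_natr.
by do 2![case: (_ == v)]; rewrite ?mulr1n ?mulr0n ?subr0 ?sub0r ?addr0 ?add0r.
Qed.

Definition node_sol e : R -> R := sol t (node y e 0) (flux_left e 0).

(** Both sides satisfy [f (x + h) = 2 cosl(h) f x - f (x - h)], for the nodes by [flux_match], and
    they agree at the first two nodes. *)
Lemma node_solE e j : (j <= m.+1)%N -> node_sol e (j%:R * mesh e) = node y e j.
Proof.
have recE x : node_sol e (x + mesh e) =
    2 * cosl t (mesh e) * node_sol e x - node_sol e (x - mesh e).
  by rewrite /node_sol !solD coslN sinlN; ring.
have sol1 : node_sol e (mesh e) = node y e 1.
  rewrite /node_sol /sol /flux_left; field; exact: S0.
suff h k : (k < m.+1)%N -> node_sol e (k%:R * mesh e) = node y e k /\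
    node_sol e (k.+1%:R * mesh e) = node y e k.+1.
  by case: j => [|j] jm; [exact: (h 0%N isT).1 | exact: (h j jm).2].
elim: k => [_|k IH km]; first by rewrite mul0r mul1r sol1 /node_sol sol0.
have [IH0 IH1] := IH (ltnW km); split=> //.
have -> : k.+2%:R * mesh e = k.+1%:R * mesh e + mesh e.
  by rewrite -[in LHS]natr1 mulrDl mul1r.
have kE : k.+1%:R * mesh e - mesh e = k%:R * mesh e.
  by rewrite -natr1 mulrDl mul1r addrK.
rewrite recE IH1 kE IH0.
have := flux_match e (Ordinal (km : (k < m)%N)).
rewrite /flux_right /flux_left /= => /(mulIf (invr_neq0 (S0 e))) fE.
by rewrite -[node y e k.+2](subrK (cosl t (mesh e) * node y e k.+1)) -fE; ring.
Qed.

Lemma node_sol_deriv e :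
  dsol t (node y e 0) (flux_left e 0) (len G e) = flux_right e m.
Proof.
have := node_solE e (leqnSn m).
have -> : m%:R * mesh e = len G e - mesh e.
  by rewrite -mesh_len -natr1 mulrDl mul1r addrK.
rewrite /node_sol solD coslN sinlN -/(node_sol e _).
rewrite -{1}mesh_len node_solE// /flux_right => <-.
by field; exact: S0.
Qed.

Lemma kernel_eigen_data : eigen_data t (fun e => node y e 0)
  (fun e => flux_left e 0) (vertex_value y).
Proof.
split=> [e b|v|v /negbTE iv]; last first.
- by rewrite /vertex_value /free_vertex iv andbF.
- have [fv|nfv] := boolP (free_vertex v); last first.
    have v0 : vertex_value y v = 0 by rewrite /vertex_value (negbTE nfv).
    move: nfv; rewrite /free_vertex v0; case: (strength G v) => //= r iv.
    rewrite mulr0 addr0 big1// => e _; rewrite big1// => b /eqP eb.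
    by case/existsP: iv; exists e; apply/existsP; exists b; apply/eqP.
  have := flux_balance fv; have /andP[vD _] := fv.
  case: (strength G v) (strength_neqNy v) vD => //= r _ _ h.
  rewrite -[RHS]h; congr (_ + _).
  apply: eq_bigr => e _; apply: eq_bigr => b _; case: b => /=.
    by rewrite node_sol_deriv.
  by rewrite dsol0.
- rewrite /end_value; case: b; last by rewrite sol0.
  by rewrite -(node_last y e) -(node_solE e (leqnn _)) mesh_len.
Qed.

End Kernel.

Lemma kernel_lin_free n t (X : 'M[R]_(n, #|unknown|)) :
  (forall e, sinl t (mesh e) != 0) -> row_free X -> X *m node_mx t = 0 ->
  lin_free (fam_sol (fun=> t) (fun i e => node (row i X) e 0)
    (fun i e => flux_left t (row i X) e 0)).
Proof.
move=> S0 fX X0 x x0.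
have ker y : (y <= X)%MS -> forall z, node_form t y z = 0.
  move=> /submxP[u ->] z.
  by rewrite -node_mxE -[_ *m node_mx t]mulmxA X0 mulmx0 mul0mx mxE.
have xXE : x *m X = \sum_i x 0 i *: row i X by rewrite mulmx_sum_row.
suff xX0 : x *m X = 0 by apply: (row_free_inj fX); rewrite mul0mx.
apply: node_eq0 => [e j jm|v nfv]; last first.
  (* Only the artificial strength 1 survives in this test, so the coordinate vanishes. *)
  have := ker _ (submxMl x X) 'e_(enum_rank (inl v : unknown)).
  rewrite /node_form big1 ?add0r => [|e _].
    rewrite (bigD1 v)//= big1 ?addr0 => [|v' vv'].
      by rewrite nodal_delta eqxx mulr1 /node_strength (negbTE nfv) mul1r.
    by rewrite nodal_delta (_ : (_ == _) = false) ?mulr0//; exact: negbTE.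
  have nodeE j : (j <= m.+1)%N -> node 'e_(enum_rank (inl v : unknown)) e j = 0.
    have vv v' : vertex_value 'e_(enum_rank (inl v : unknown)) v' = 0.
      rewrite /vertex_value nodal_delta; case: ifPn => // fv'.
      by case: eqP nfv => // -[<-]; rewrite fv'.
    case: j => [_|j]; first exact: vv.
    rewrite ltnS leq_eqVlt => /predU1P[->|jm]; first by rewrite node_last vv.
    by rewrite (node_interior _ _ (Ordinal jm)) nodal_delta.
  rewrite big1// => j _; rewrite !nodeE//; last exact: ltnW.
  by rewrite /segment_bilin !mulr0 !subr0 add0r !mulr0 mul0r.
have h0 := ltW (mesh_gt0 e).
have jmesh : 0 <= j%:R * mesh e <= len G e.
  by rewrite mulr_ge0//= -mesh_len ler_wpM2r// ler_nat.
rewrite xXE (linear_for_sum (@node_linear e j)) -[RHS](x0 e _ jmesh).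
apply: eq_bigr => i _; congr (_ * _).
rewrite -(node_solE S0 (ker _ (row_sub i X)))//.
Qed.

(** On each segment the nodal form is the minimum over functions with these end values, and the
    vertex terms coincide. *)
Lemma node_form_energy l g dg c : test_function g dg c ->
  (forall e, Num.sqrt l * mesh e < pi) ->
  forall y, (forall e (i : 'I_m), nodal y (inr (e, i)) = g e (i.+1%:R * mesh e)) ->
  (forall v, nodal y (inl v) = if free_vertex v then c v else 0) ->
  node_form l y y <= energy l g dg c.
Proof.
move=> [gd cdg gc gD gI] lh y yE yV.
have c0 v : ~~ free_vertex v -> incident v -> c v = 0.
  by rewrite /free_vertex negb_and negbK => /orP[/eqP/gD//|/negbTE->].
have vvE e b : vertex_value y (edge_end G e b) = c (edge_end G e b).
  rewrite /vertex_value yV; case: (boolP (free_vertex _)) => // nfv.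
  rewrite (c0 _ nfv)//.
  by apply/existsP; exists e; apply/existsP; exists b.
have nodeE e j : (j <= m.+1)%N -> node y e j = g e (j%:R * mesh e).
  case: j => [_|j].
    by rewrite mul0r [LHS]vvE -gc.
  rewrite ltnS leq_eqVlt => /predU1P[->|jm].
    by rewrite node_last vvE -gc mesh_len.
  by rewrite (node_interior _ _ (Ordinal jm)) yE.
rewrite /node_form /energy lerD//.
  apply: ler_sum => e _; rewrite -(mesh_len e).
  apply: le_trans (edge_min (ltn0Sn m) (mesh_gt0 e) (lh e) (gd e) (cdg e)).
  rewrite le_eqVlt; apply/orP; left; apply/eqP; apply: eq_bigr => j _.
  by rewrite segment_bilinE !nodeE// ltnW.
apply: ler_sum => v _; rewrite yV /node_strength.
case: ifPn => [_|nfv]; first by rewrite -mulrA -expr2.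
rewrite !mulr0; move: nfv; rewrite /free_vertex negb_and negbK => /orP[/eqP->|/gI].
  by rewrite mul0r.
by rewrite expr2 mulrA => ->; rewrite mul0r.
Qed.

(** With [Gam] the sum of the absolute strengths, a segment contributes at least [Gam + 1] times the
    squares of its end values. Each free vertex value is such an end value, so the strengths cost at
    most [Gam] and one copy remains. *)
Lemma node_form_coercive (k : R) :
  (\sum_v `|fine (strength G v)|) + 1 + \sum_e (mesh e)^-1 <= k ->
  forall y, y != 0 -> 0 < node_form (- k ^+ 2) y y.
Proof.
move=> kM y; set l := - k ^+ 2; set Gam := \sum_v _ in kM.
have Gam0 : 0 <= Gam by rewrite sumr_ge0.
pose sq e := \sum_(j < m.+1) (node y e j ^+ 2 + node y e j.+1 ^+ 2).
have sq0 e : 0 <= sq e.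
  by apply: sumr_ge0 => j _; rewrite addr_ge0 ?sqr_ge0.
pose X := \sum_e sq e.
have X0 : 0 <= X by exact: sumr_ge0.
have nodeX e j : (j <= m.+1)%N -> node y e j ^+ 2 <= X.
  move=> jm; apply: (@le_trans _ _ (sq e)); last first.
    by rewrite /X (bigD1 e)//= lerDl sumr_ge0.
  case: j jm => [_|j jm].
    by rewrite /sq big_ord_recl/= -addrA lerDl addr_ge0 ?sqr_ge0// sumr_ge0// => i _;
       rewrite addr_ge0 ?sqr_ge0.
  rewrite /sq (bigD1 (Ordinal jm))//= addrAC lerDr addr_ge0 ?sqr_ge0// sumr_ge0// => i _.
  by rewrite addr_ge0 ?sqr_ge0.
have edgeX : (Gam + 1) * X <= \sum_e \sum_(j < m.+1) segment_bilin l (mesh e)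
    (node y e j) (node y e j.+1) (node y e j) (node y e j.+1).
  rewrite /X mulr_sumr; apply: ler_sum => e _.
  rewrite /sq mulr_sumr; apply: ler_sum => j _.
  rewrite segment_bilinE /segment_form.
  have h0 := mesh_gt0 e.
  have k0 : 0 < k.
    rewrite (lt_le_trans _ kM)// ltr_pwDl// ?ltr_wpDl// sumr_ge0// => e' _.
    by rewrite invr_ge0 ltW// mesh_gt0.
  have l0 : l < 0 by rewrite oppr_lt0 exprn_gt0.
  have s0 : 0 < sinl l (mesh e) by rewrite (lt_le_trans h0)// ler_sinl// ltW.
  have hk : Gam + 1 + (mesh e)^-1 <= k.
    rewrite (le_trans _ kM)// lerD2l (bigD1 e)//= lerDl sumr_ge0// => e' _.
    by rewrite invr_ge0 ltW// mesh_gt0.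
  have := cosl_sinl_coercive (addr_ge0 Gam0 ler01) h0 hk erefl.
  rewrite -/l ler_pdivlMr// => CS.
  move: (node y e j) (node y e j.+1) => p q.
  have := sqr_ge0 (p - q); have := sqr_ge0 p; have := sqr_ge0 q.
  move=> q0 p0 pq0; have pq : 0 <= p ^+ 2 + q ^+ 2 by exact: addr_ge0.
  have := ler_wpM2r pq CS; nra.
have vertX : - (Gam * X) <= \sum_(v | free_vertex v)
    node_strength v * nodal y (inl v) * nodal y (inl v).
  apply: (@le_trans _ _ (\sum_(v | free_vertex v) - (`|fine (strength G v)| * X))).
    rewrite sumrN lerN2 -mulr_suml ler_wpM2r// /Gam [leRHS](bigID free_vertex)/=.
    by rewrite lerDl sumr_ge0.
  apply: ler_sum => v fv; rewrite /node_strength fv -mulrA -expr2.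
  have [e [j [jm ->]]] := nodal_free y fv.
  rewrite lerNl -mulNr (le_trans (ler_wpM2r (sqr_ge0 _) (ler_norm _)))//.
  by rewrite normrN ler_wpM2l// nodeX.
pose Y := \sum_(v | ~~ free_vertex v) nodal y (inl v) ^+ 2.
have Y0 : 0 <= Y by rewrite sumr_ge0// => v _; rewrite sqr_ge0.
have YE : \sum_(v | ~~ free_vertex v)
    node_strength v * nodal y (inl v) * nodal y (inl v) = Y.
  by apply: eq_bigr => v fv; rewrite /node_strength (negbTE fv) mul1r expr2.
have lower : X + Y <= node_form l y y.
  by rewrite /node_form [X in _ <= _ + X](bigID free_vertex)/= YE; lra.
move=> y0; apply: lt_le_trans lower; rewrite lt_def addr_ge0// andbT.
apply: contra_neq y0 => XY0.
have X00 : X = 0 by lra.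
have Y00 : Y = 0 by lra.
apply: node_eq0 => [e j jm|v nfv].
  apply/eqP; rewrite -sqrf_eq0 eq_le sqr_ge0 andbT -X00; exact: nodeX.
apply/eqP; rewrite -sqrf_eq0 eq_le sqr_ge0 andbT -Y00 /Y (bigD1 v)//= lerDl.
by rewrite sumr_ge0// => v' _; rewrite sqr_ge0.
Qed.

End Discretisation.

(** * The variational principle *)

Section Existence.
Variables (R : realType) (G : metric_graph R).
Implicit Types (t mu : R).

Lemma eigenvalues_below_le n t t' : t <= t' ->
  eigenvalues_below G n t -> eigenvalues_below G n t'.
Proof.
move=> tt' [nu [f [nut fE ff]]]; exists nu, f; split=> // i.
exact: le_trans tt'.
Qed.

Lemma eigenvalues_below_leq n n' t : (n' <= n)%N ->
  eigenvalues_below G n t -> eigenvalues_below G n' t.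
Proof.
move=> /subnKC <-; set d := (n - n')%N => -[nu [f [nut fE ff]]].
exists (fun i => nu (lshift d i)), (fun i => f (lshift d i)); split=> // a a0 i.
rewrite -(cat_funl a (fun _ : 'I_d => 0)); apply: ff => e s es.
rewrite big_split_ord/= [X in _ + X]big1 => [|j _]; last first.
  by rewrite cat_funr mul0r.
rewrite addr0 -[RHS](a0 e s es).
by apply: eq_bigr => j _; rewrite cat_funl.
Qed.

Lemma eigenvalues_below0 t : eigenvalues_below G 0 t.
Proof.
by exists (fun=> 0), (fun _ _ _ => 0); split=> [[]|[]|a _ []].
Qed.

Lemma eigenvalues_below_cat n n' s t nu (A B : 'I_n' -> edge G -> R) c : s < t ->
  eigenvalues_below G n s -> (forall i, nu i = t) ->
  (forall i, eigen_data (nu i) (A i) (B i) (c i)) ->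
  lin_free (fam_sol nu A B) ->
  eigenvalues_below G (n + n') t.
Proof.
move=> st /below_family[nu' [A' [B' [c' [nus AB' ff']]]]] nut AB ff.
have nu't i : nu' i < t by exact: le_lt_trans st.
apply: (family_below (c := cat_fun c' c) _ _ (lin_free_cat nu't nut AB' AB ff' ff)).
  move=> i; rewrite /cat_fun; case: fintype.split => j; first exact: ltW.
  by rewrite nut.
by move=> i; rewrite /cat_fun; case: fintype.split.
Qed.

Definition test_space n (g dg : 'rV[R]_n -> edge G -> R -> R)
    (c : 'rV[R]_n -> vertex G -> R) : Prop :=
  [/\ forall x, test_function (g x) (dg x) (c x),
      forall e s, linear_for *%R (fun x => g x e s),
      forall v, linear_for *%R (fun x => c x v)
    & forall x, (forall e s, 0 <= s <= len G e -> g x e s = 0) -> x = 0].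

Section Mesh.
Variables (m : nat) (Lam : R).
Hypothesis mesh_small : forall e : edge G, Num.sqrt Lam * mesh m e < pi.

Let mesh_small_le t (e : edge G) : t <= Lam -> Num.sqrt t * mesh m e < pi.
Proof.
move=> tL; apply: le_lt_trans (mesh_small e).
by rewrite ler_wpM2r ?ler_wsqrtr// ltW// mesh_gt0.
Qed.

Let sinl_mesh t (e : edge G) : t <= Lam -> sinl t (mesh m e) != 0.
Proof.
by move=> tL; rewrite gt_eqF// sinl_gt0 ?mesh_gt0// mesh_small_le.
Qed.

(** Supplies the hypothesis [K_ker] of the count. *)
Lemma node_mx_eigenvalues n n' t s (X : 'M[R]_(n', #|unknown G m|)) :
  t <= Lam -> s < t -> row_free X -> X *m node_mx G m t = 0 ->
  eigenvalues_below G n s -> eigenvalues_below G (n + n') t.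
Proof.
move=> tL st fX X0 Ks.
have S0 (e : edge G) := sinl_mesh e tL.
apply: (eigenvalues_below_cat st Ks _ _ (kernel_lin_free S0 fX X0)) => // i.
apply: (kernel_eigen_data S0) => z.
by rewrite -node_mxE -row_mul X0 row0 mul0mx mxE.
Qed.

Definition sample n (g : 'rV[R]_n -> edge G -> R -> R)
    (c : 'rV[R]_n -> vertex G -> R) x : 'rV[R]_#|unknown G m| :=
  \row_(k < #|unknown G m|) match enum_val k : unknown G m with
         | inl v => if free_vertex v then c x v else 0
         | inr (e, i) => g x e (i.+1%:R * mesh m e)
         end.

Definition sample_mx n (g : 'rV[R]_n -> edge G -> R -> R) c :
  'M[R]_(n, #|unknown G m|) := \matrix_(i < n, j < #|unknown G m|) sample g c 'e_i 0 j.

Lemma sample_mxE n (g dg : 'rV[R]_n -> edge G -> R -> R) c x :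
  test_space g dg c -> x *m sample_mx g c = sample g c x.
Proof.
move=> [_ gl cl _]; apply/rowP => k; rewrite !mxE.
under eq_bigr do rewrite !mxE.
case: (enum_val k) => [v|[e i]].
  case: ifP => _; last by rewrite big1// => j _; rewrite mulr0.
  by rewrite [in RHS](row_sum_delta x) (linear_for_sum (cl v)).
by rewrite [in RHS](row_sum_delta x) (linear_for_sum (gl e _)).
Qed.

Lemma sample_energy n (g dg : 'rV[R]_n -> edge G -> R -> R) c t x :
  test_space g dg c -> t <= Lam ->
  qform (node_mx G m t) (x *m sample_mx g c) <= energy t (g x) (dg x) (c x).
Proof.
move=> T tL; have [Tx _ _ _] := T.
rewrite (sample_mxE x T) qform_node_mx; apply: node_form_energy => //.
- by move=> e; exact: mesh_small_le.
- by move=> e i; rewrite /nodal mxE enum_rankK.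
- by move=> v; rewrite /nodal mxE enum_rankK.
Qed.

(** A function with zero samples has nonnegative energy at [Lam]. Its energy at mu is nonpositive
    and exceeds the former by [(Lam - mu)] times the square norm, which is therefore 0. *)
Lemma sample_mx_free n (g dg : 'rV[R]_n -> edge G -> R -> R) c mu :
  test_space g dg c -> mu < Lam ->
  (forall x, energy mu (g x) (dg x) (c x) <= 0) -> row_free (sample_mx g c).
Proof.
move=> T muL gE; apply: inj_row_free => x x0.
have [Tx _ _ inj] := T; apply: inj.
have cg : forall e, continuous (g x e) := test_function_continuous (Tx x).
have cdg e : continuous (dg x e) by have [_ h _ _ _] := Tx x; exact: h.
apply: inner_eq0 => //; apply/eqP; rewrite eq_le inner_ge0 andbT.
have := sample_energy x T (lexx Lam).
rewrite x0 /qform !mul0mx mxE; have := gE x; rewrite !energyE//.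
move: (inner (dg x) (dg x)) (inner (g x) (g x)) => X Y h1 h2.
have : (Lam - mu) * Y <= 0 by lra.
by rewrite pmulr_rle0// subr_gt0.
Qed.

Lemma node_mx_continuous t : t <= Lam -> forall i j,
  {for t, continuous (fun s => node_mx G m s i j)}.
Proof. by move=> tL i j; apply: continuous_node_mx => e; exact: sinl_mesh. Qed.

End Mesh.

Lemma ex_mesh Lam : exists m, forall e : edge G, Num.sqrt Lam * mesh m e < pi.
Proof.
pose L := \sum_(e : edge G) len G e.
have lenL (e : edge G) : len G e <= L.
  by rewrite /L (bigD1 e)//= lerDl sumr_ge0// => e' _; rewrite ltW// len_gt0.
have L0 : 0 <= L by rewrite sumr_ge0// => e _; rewrite ltW// len_gt0.
have x0 : 0 <= Num.sqrt Lam * L / pi by rewrite divr_ge0 ?mulr_ge0 ?sqrtr_ge0// pi_ge0.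
exists (Num.bound (Num.sqrt Lam * L / pi)) => e.
rewrite /mesh mulrA ltr_pdivrMr// (@le_lt_trans _ _ (Num.sqrt Lam * L))//.
  by rewrite ler_wpM2l ?sqrtr_ge0.
rewrite [ltRHS]mulrC -ltr_pdivrMr ?pi_gt0// (lt_trans (archi_boundP x0))//.
by rewrite ltr_nat.
Qed.

Lemma ex_coercive mu m : exists2 a, a < mu &
  forall y, y != 0 -> 0 < qform (node_mx G m a) y.
Proof.
pose M := (\sum_(v : vertex G) `|fine (strength G v)|) + 1 +
  \sum_(e : edge G) (mesh m e)^-1.
have M0 : 0 <= M.
  rewrite !addr_ge0// ?sumr_ge0// => e _.
  by rewrite invr_ge0 ltW// mesh_gt0.
(* Chosen to pass the coercivity threshold [M] and to have [- k ^+ 2 < mu]. *)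
pose k := M + `|mu| + 1.
have mu0 := normr_ge0 mu; have mu1 := ler_normr (- `|mu|) mu.
exists (- k ^+ 2).
  have : - `|mu| <= mu by rewrite lerNl -normrN ler_norm.
  by rewrite /k; nra.
move=> y y0; rewrite qform_node_mx; apply: node_form_coercive => //.
by rewrite -/M /k -addrA lerDl addr_ge0.
Qed.

(* The min-max principle, in the direction that produces eigenvalues. *)
Theorem eigenvalues_below_of_test_space n (g dg : 'rV[R]_n -> edge G -> R -> R)
    c mu : test_space g dg c ->
  (forall x, energy mu (g x) (dg x) (c x) <= 0) -> eigenvalues_below G n mu.
Proof.
move=> T gE.
(* The extra 1 is the margin that makes sampling injective. *)
have [m mP] := ex_mesh (mu + 1); have [a amu aP] := ex_coercive mu m.
have mu1 : mu < mu + 1 by rewrite ltrDl.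
have fU := sample_mx_free mP T mu1 gE.
have amumu : a <= mu <= mu by rewrite lexx ltW.
apply: (count_of_nonpositive (b := mu) (@node_mx_sym _ G m) _ aP eigenvalues_below0
  (fun _ _ _ => @eigenvalues_below_leq _ _ _) (fun _ _ _ => @eigenvalues_below_le _ _ _)
  _ amumu fU) => [t /andP[_ tmu]|n1 n2 t s X /andP[_ tmu] st fX X0|x].
- exact: (node_mx_continuous mP (le_trans tmu (ltW mu1))).
- exact: (node_mx_eigenvalues mP (le_trans tmu (ltW mu1)) st fX X0).
- by rewrite (le_trans (sample_energy mP x T (ltW mu1))).
Qed.

(** Here a mesh for mu itself suffices: strict negativity of the sampled form already forces
    independence of the samples. *)
Theorem eigenvalues_below_lt_of_test_space n
    (g dg : 'rV[R]_n -> edge G -> R -> R) c mu : test_space g dg c ->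
  (forall x, x != 0 -> energy mu (g x) (dg x) (c x) < 0) ->
  exists2 t, t < mu & eigenvalues_below G n t.
Proof.
move=> T gE.
have [m mP] := ex_mesh mu; have [a amu aP] := ex_coercive mu m.
apply: (count_of_negative (U := sample_mx m g c) (@node_mx_sym _ G m) _ aP eigenvalues_below0
  (fun _ _ _ => @eigenvalues_below_leq _ _ _) (fun _ _ _ => @eigenvalues_below_le _ _ _)
  _ amu) => [t /andP[_ tmu]|n1 n2 t s X /andP[_ tmu] st fX X0|x x0].
- exact: (node_mx_continuous mP tmu).
- exact: (node_mx_eigenvalues mP tmu st fX X0).
- exact: le_lt_trans (sample_energy mP x T (lexx mu)) (gE x x0).
Qed.

End Existence.

(** * Test functions on the modified graphs *)

Section Surgeries.
Variable R : realType.
Implicit Types (G H : metric_graph R) (mu t : R).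

Lemma incident_end G e b : incident (edge_end G e b).
Proof. by apply/existsP; exists e; apply/existsP; exists b. Qed.

(** [fine] maps [+oo] to 0 and is not additive; the factor [c] vanishes in exactly those cases. *)
Lemma fineD_mul (a b : \bar R) (c : R) : a != -oo%E -> b != -oo%E ->
  (a = +oo%E -> c = 0) -> (b = +oo%E -> c = 0) ->
  fine (a + b)%E * c = fine a * c + fine b * c.
Proof.
case: a b => [a||] [b||]//= _ _ ha hb; first by rewrite mulrDl.
- by rewrite hb// !mulr0 addr0.
- by rewrite ha// !mulr0 addr0.
- by rewrite ha// !mulr0 addr0.
Qed.

Lemma big_sub_pred (I : finType) (P : pred I) (F : I -> R) :
  \sum_(u : {u : I | P u}) F (val u) = \sum_(u | P u) F u.
Proof.
rewrite [RHS](reindex_omap (val : {u | P u} -> I) insub) => [|u Pu]; last first.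
  by rewrite insubT.
by apply: eq_bigl => u; rewrite valK eqxx andbT (valP u).
Qed.

Lemma big_option_pred (I : finType) (F : option I -> R) :
  \sum_(u : option I) F u = F None + \sum_(u : I) F (Some u).
Proof.
rewrite (bigD1 None)//=; congr (_ + _).
by rewrite (reindex_omap Some id)/= => [|[]//]; apply: eq_bigl => u; rewrite eqxx.
Qed.

Definition union_fun (S T U : Type) (f : S -> U) (h : T -> U) (e : S + T) : U :=
  match e with inl e => f e | inr e => h e end.

Section Attach.
Variables (G H : metric_graph R) (v0 : vertex G) (w1 : vertex H).

Let glued : pred (vertex (disjoint_union G H)) :=
  [pred v | (v == inl v0) || (v == inr w1)].

Definition attach_value (cf : vertex G -> R) (ch : vertex H -> R)
    (v : vertex (attach v0 w1)) : R :=
  match v with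
  | Some u => union_fun cf ch (val u)
  | None => cf v0
  end.

Lemma attach_value_proj cf ch u : cf v0 = ch w1 ->
  attach_value cf ch (glue_proj glued u) = union_fun cf ch u.
Proof.
move=> c0; rewrite /glue_proj; case: insubP => [x _ xu|] /=; first by rewrite xu.
by rewrite negbK => /orP[]/eqP->.
Qed.

Lemma attach_incident_proj u :
  (match u with inl v => incident v | inr w => incident w end) ->
  @incident _ (attach v0 w1) (glue_proj glued u).
Proof.
case: u => [v|w] /existsP[e /existsP[b /eqP <-]].
  exact: (@incident_end (attach v0 w1) (inl e) b).
exact: (@incident_end (attach v0 w1) (inr e) b).
Qed.

Lemma attach_strength_None :
  strength (attach v0 w1) None = (strength G v0 + strength H w1)%E.
Proof.
rewrite /= (bigD1 (inl v0 : vertex (disjoint_union G H)))/=; last by rewrite eqxx.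
rewrite (big_pred1 (inr w1 : vertex (disjoint_union G H)))//.
by case=> [v|w] /=; rewrite ?orbF ?andbT ?andbN.
Qed.

Lemma attach_test_function f df cf h dh ch :
  @test_function _ G f df cf -> @test_function _ H h dh ch -> cf v0 = ch w1 ->
  @test_function _ (attach v0 w1) (union_fun f h) (union_fun df dh)
    (attach_value cf ch).
Proof.
move=> [fd cdf fc fD fI] [hd cdh hc hD hI] c0; split.
- by case=> e; [exact: fd | exact: hd].
- by case=> e; [exact: cdf | exact: cdh].
- case=> e b.
    by rewrite (attach_value_proj (inl (edge_end G e b)) c0)/= -fc.
  by rewrite (attach_value_proj (inr (edge_end H e b)) c0)/= -hc.
- case=> [[[v|w] /= _]|]; [exact: fD | exact: hD|].
  rewrite attach_strength_None /=.
  (* An infinite sum has an infinite summand, whose Dirichlet condition forces the common value to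
     be 0. *)
  case sG : (strength G v0) (strength_neqNy v0) => [a||]// _; last by rewrite fD.
  by rewrite c0; case sH : (strength H w1) => [b||]// _; exact: hD.
- have projE (u : {u | ~~ glued u}) : glue_proj glued (val u) = Some u.
    by rewrite /glue_proj valK.
  case=> [u|] iv.
    rewrite -projE in iv; have {iv} := contra (@attach_incident_proj (val u)) iv.
    by case: u => -[v|w] /= _; [exact: fI | exact: hI].
  have N0 : glue_proj glued (inl v0) = None.
    by rewrite /glue_proj insubF//; apply/negbTE; rewrite negbK /glued/= eqxx.
  have N1 : glue_proj glued (inr w1) = None.
    by rewrite /glue_proj insubF//; apply/negbTE; rewrite negbK /glued/= eqxx.
  have i0 := contra (@attach_incident_proj (inl v0)); rewrite N0 in i0.
  have i1 := contra (@attach_incident_proj (inr w1)); rewrite N1 in i1.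
  rewrite attach_strength_None fineD_mul ?strength_neqNy//=.
  + by rewrite fI ?i0// c0 hI ?i1// addr0.
  + exact: fD.
  + by rewrite c0; exact: hD.
Qed.

Lemma attach_energy mu f df cf h dh ch :
  @test_function _ G f df cf -> @test_function _ H h dh ch -> cf v0 = ch w1 ->
  @energy _ (attach v0 w1) mu (union_fun f h) (union_fun df dh)
    (attach_value cf ch) =
  @energy _ G mu f df cf + @energy _ H mu h dh ch.
Proof.
move=> [_ _ _ fD _] [_ _ _ hD _] c0.
rewrite /energy big_sumType/= addrACA; congr (_ + _).
rewrite big_option_pred.
pose F u := fine (strength (disjoint_union G H) u) * union_fun cf ch u ^+ 2.
rewrite [X in _ + X](big_sub_pred _ F).
have -> : fine (strength (attach v0 w1) None) * attach_value cf ch None ^+ 2 =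
    \sum_(u | glued u) F u.
  rewrite attach_strength_None (bigD1 (inl v0 : vertex (disjoint_union G H)))/=; last by rewrite /glued/= eqxx.
  rewrite (big_pred1 (inr w1 : vertex (disjoint_union G H))).
    rewrite /F/= fineD_mul ?strength_neqNy ?c0//.
      by move=> /fD; rewrite c0 => ->; rewrite expr0n.
    by move=> /hD ->; rewrite expr0n.
  by rewrite /glued; case=> [v|w] /=; rewrite ?orbF ?andbT ?andbN.
have FE : \sum_(u | glued u) F u + \sum_(u | ~~ glued u) F u = \sum_u F u.
  by rewrite [RHS](bigID glued).
by rewrite FE big_sumType.
Qed.

End Attach.
Section Insert.
Variables (G H : metric_graph R) (v0 : vertex G).
Variables (w : edge G -> bool -> vertex H) (s : vertex H -> R).
Hypothesis natural : forall u, strength H u = 0%E.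
Hypothesis strength_v0 : strength G v0 = (\sum_(u | insert_used v0 w u) s u)%:E.

Definition insert_value (cf : vertex G -> R)
    (u : {v : vertex G | v != v0} + vertex H) : R :=
  match u with inl v => cf (val v) | inr _ => cf v0 end.

Definition insert_fun (f : edge G -> R -> R) (a : R) :
  edge G + edge H -> R -> R := union_fun f (fun _ _ => a).

Lemma insert_value_end cf e b :
  insert_value cf (edge_end (insert v0 w s) (inl e) b) = cf (edge_end G e b).
Proof.
rewrite /=; case: insubP => [x _ /= ->//|] /=.
by rewrite negbK => /eqP ->.
Qed.

Lemma insert_test_function f df cf : @test_function _ G f df cf ->
  @test_function _ (insert v0 w s) (insert_fun f (cf v0)) (insert_fun df 0)
    (insert_value cf).
Proof.
move=> [fd cdf fc fD fI]; split.
- by case=> e x /=; [exact: fd | exact: is_derive_cst].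
- by case=> e /=; [exact: cdf | move=> x; exact: cvg_cst].
- case=> e b; first by rewrite insert_value_end -fc.
  by rewrite /end_value/=; case: b.
- case=> [[v vv0]|u] /=; first exact: fD.
  by case: ifP => //; rewrite natural.
- case=> [[v vv0]|u] iv /=.
    apply: fI; apply: contra iv => /existsP[e /existsP[b /eqP eb]].
    apply/existsP; exists (inl e); apply/existsP; exists b; apply/eqP => /=.
    by case: insubP => [x _ xe|]; [congr inl; apply: val_inj; rewrite xe|rewrite eb vv0].
  rewrite ifF ?natural ?mul0r//; apply: contraNF iv.
  move=> /existsP[e /existsP[b /andP[/eqP eb /eqP web]]].
  apply/existsP; exists (inl e); apply/existsP; exists b; apply/eqP => /=.
  by rewrite insubF ?web// eb eqxx.
Qed.

(** The constant on [H] has no Dirichlet energy and contributes only its mass term; all inserted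
    vertices carry the value at [v0], so their strengths recombine to that of [v0]. *)
Lemma insert_energy mu f df cf :
  @energy _ (insert v0 w s) mu (insert_fun f (cf v0)) (insert_fun df 0)
    (insert_value cf) =
  @energy _ G mu f df cf - mu * cf v0 ^+ 2 * \sum_e len H e.
Proof.
rewrite /energy !big_sumType/=.
have -> : \sum_e integral_to (len H e) (fun=> 0 ^+ 2 - mu * cf v0 ^+ 2) =
    - (mu * cf v0 ^+ 2 * \sum_e len H e).
  rewrite mulr_sumr -sumrN; apply: eq_bigr => e _.
  set a := mu * _.
  have d (x : R) : is_derive x 1 (fun x => - a * x) (0 ^+ 2 - a).
    by apply: is_derive_eq; rewrite /GRing.scale/= expr0n/=; ring.
  have c : continuous (fun _ : R => 0 ^+ 2 - a) by move=> x; exact: cvg_cst.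
  rewrite (integral_to_primitive (len_gt0 e) c (fun x _ => d x)).
  by rewrite mulr0 subr0 mulNr.
have -> : \sum_u fine (if insert_used v0 w u then (s u)%:E else strength H u) *
    cf v0 ^+ 2 = fine (strength G v0) * cf v0 ^+ 2.
  rewrite strength_v0/= -mulr_suml; congr (_ * _).
  by rewrite [RHS]big_mkcond; apply: eq_bigr => u _; case: ifP => // _; rewrite natural.
rewrite (big_sub_pred (fun v => v != v0) (fun v => fine (strength G v) * cf v ^+ 2)).
rewrite [X in _ = _ + X - _](bigD1 v0)//=.
by ring.
Qed.

End Insert.
End Surgeries.

(** * Comparison of eigenvalue counts *)

Section Comparison.
Variable R : realType.
Implicit Types (G H : metric_graph R) (mu t : R).

Lemma lambda_le G k t : eigenvalues_below G k t -> (lambda G k <= t%:E)%E.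
Proof. by move=> h; apply: ereal_inf_lbound; exists t. Qed.

Lemma lambda_lt G k (t : R) : (lambda G k < t%:E)%E ->
  exists2 s, s < t & eigenvalues_below G k s.
Proof. by move=> /ereal_inf_lt[_ [s sk <-]]; rewrite lte_fin => st; exists s. Qed.

Lemma lambda_lt_below G k t : (lambda G k < t%:E)%E -> eigenvalues_below G k t.
Proof. by move=> /lambda_lt[s /ltW st]; exact: eigenvalues_below_le. Qed.

(** Comparing at every level above the infimum replaces a proof that it is attained. *)
Lemma le_lambda G k (x : \bar R) :
  (forall t, (lambda G k < t%:E)%E -> (x <= t%:E)%E) -> (x <= lambda G k)%E.
Proof.
move=> h; apply: le_ereal_inf_tmp => _ [mu muk <-]; apply/lee_addgt0Pr => e e0.
rewrite -EFinD; apply: h; apply: le_lt_trans (lambda_le muk) _.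
by rewrite lte_fin ltrDl.
Qed.

Lemma damp_eq0 n (nu : 'I_n -> R) mu (x : 'rV[R]_n) i :
  damp nu mu x = 0 -> nu i < mu -> x 0 i = 0.
Proof.
move=> /rowP/(_ i); rewrite !mxE => /eqP; rewrite mulf_eq0 => /orP[/eqP//|].
by rewrite sqrtr_eq0 subr_le0 leNgt => /negbTE ->.
Qed.

(** The given eigenfunction takes the last index; the others have eigenvalues below mu, whence
    independence. *)
Lemma family_rcons G n s mu f v0 : eigenvalues_below G n s -> s < mu ->
  eigenfunction mu f -> nonvanishing_at v0 f ->
  exists (nu : 'I_(n + 1) -> R) (A B : 'I_(n + 1) -> edge G -> R) c,
  [/\ forall i, nu i <= mu, forall i, nu (lshift 1 i) < mu,
      forall i, eigen_data (nu i) (A i) (B i) (c i),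
      lin_free (fam_sol nu A B) & c (rshift n 0) v0 != 0].
Proof.
move=> /below_family[nu [A [B [c [nus AB ff]]]]] smu [fE _] [e [b [<- eb0]]].
have [A' [B' [c' [AB' fE']]]] := eigenspace_data fE.
have numu i : nu i < mu by exact: le_lt_trans smu.
have len0 e' : 0 <= len G e' by rewrite ltW// len_gt0.
pose one T (a : T) (i : 'I_1) := a.
have ends : 0 <= (if b then len G e else 0) <= len G e.
  by case: b {eb0}; rewrite ?len0 ?lexx.
have ff' : lin_free (fam_sol (one _ mu) (one _ A') (one _ B')).
  move=> x /(_ e _ ends); rewrite /comb big_ord1 /fam_sol /one -fE'// => /eqP.
  rewrite mulf_eq0 [_ == 0 in X in _ || X](negbTE eb0) orbF => /eqP x0.
  by apply/rowP => i; rewrite ord1 x0 mxE.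
exists (cat_fun nu (one _ mu)), (cat_fun A (one _ A')), (cat_fun B (one _ B')),
  (cat_fun c (one _ c')); split.
- by move=> i; rewrite /cat_fun; case: fintype.split => j; [exact: ltW | exact: lexx].
- by move=> i; rewrite cat_funl.
- by move=> i; rewrite /cat_fun; case: fintype.split.
- by apply: (lin_free_cat numu _ AB (c' := one _ c')).
- rewrite cat_funr /one; have [<- _ _] := AB'.
  by rewrite /end_value -fE'.
Qed.

Section AttachSpace.
Variables (G H : metric_graph R) (v0 : vertex G) (w1 : vertex H) (p q : nat).
Variables (nu : 'I_p -> R) (A B : 'I_p -> edge G -> R) (c : 'I_p -> vertex G -> R).
Variables (nu' : 'I_q -> R) (A' B' : 'I_q -> edge H -> R) (c' : 'I_q -> vertex H -> R).
Hypothesis AB : forall i, eigen_data (nu i) (A i) (B i) (c i).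
Hypothesis AB' : forall i, eigen_data (nu' i) (A' i) (B' i) (c' i).
Hypothesis ff : lin_free (fam_sol nu A B).
Hypothesis ff' : lin_free (fam_sol nu' A' B').
(** The rows of [X] are independent coefficient vectors on [G] and [H] together whose values at [v0]
    and [w1] agree. *)
Variables (n : nat) (X : 'M[R]_(n, p + q)).
Hypothesis fX : row_free X.
Hypothesis X0 : X *m \col_i cat_fun (c ^~ v0) (fun j => - c' j w1) i = 0.

Let yl (x : 'rV[R]_n) := lsubmx (x *m X).
Let yr (x : 'rV[R]_n) := rsubmx (x *m X).

Let glue_eq x : vcomb (yl x) c v0 = vcomb (yr x) c' w1.
Proof.
apply/eqP; rewrite -subr_eq0; apply/eqP.
have /matrixP/(_ 0 0) : x *m X *m \col_i cat_fun (c ^~ v0) (fun j => - c' j w1) i = 0.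
  by rewrite -mulmxA X0 mulmx0.
rewrite !mxE big_split_ord/= => h; rewrite -[RHS]h -sumrN; congr (_ + _).
  by apply: eq_bigr => i _; rewrite !mxE cat_funl.
by apply: eq_bigr => i _; rewrite !mxE cat_funr mulrN.
Qed.

Definition attach_g x := union_fun (comb (yl x) (fam_sol nu A B))
  (comb (yr x) (fam_sol nu' A' B')).
Definition attach_dg x := union_fun (comb (yl x) (fam_dsol nu A B))
  (comb (yr x) (fam_dsol nu' A' B')).
Definition attach_c x := @attach_value _ G H v0 w1 (vcomb (yl x) c) (vcomb (yr x) c').

Let yl_linear a x x' : yl (a *: x + x') = a *: yl x + yl x'.
Proof. by rewrite /yl mulmxDl -scalemxAl linearP. Qed.

Let yr_linear a x x' : yr (a *: x + x') = a *: yr x + yr x'.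
Proof. by rewrite /yr mulmxDl -scalemxAl linearP. Qed.

Let y_eq0 x : yl x = 0 -> yr x = 0 -> x = 0.
Proof.
move=> l0 r0; apply: (row_free_inj fX); rewrite mul0mx -(hsubmxK (x *m X)).
by rewrite -/(yl x) -/(yr x) l0 r0 row_mx0.
Qed.

Lemma attach_test_space : @test_space _ (attach v0 w1) n attach_g attach_dg attach_c.
Proof.
split=> [x|e s a x x'|v a x x'|x x0].
- by apply: attach_test_function (glue_eq x); exact: fam_test_function.
- by case: e => e; rewrite /attach_g /= ?yl_linear ?yr_linear comb_linear.
- case: v => [[[v|w] /= _]|]; rewrite /attach_c /attach_value /=
    ?yl_linear ?yr_linear ?vcomb_linear//.
- apply: y_eq0.
    by apply: ff => e s es; exact: (x0 (inl e) s es).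
  by apply: ff' => e s es; exact: (x0 (inr e) s es).
Qed.

Lemma attach_space_energy mu x : (forall i, nu i <= mu) ->
  (forall i, nu' i <= mu) ->
  @energy _ (attach v0 w1) mu (attach_g x) (attach_dg x) (attach_c x) =
  - (inner (comb (damp nu mu (yl x)) (fam_sol nu A B))
           (comb (damp nu mu (yl x)) (fam_sol nu A B)) +
     inner (comb (damp nu' mu (yr x)) (fam_sol nu' A' B'))
           (comb (damp nu' mu (yr x)) (fam_sol nu' A' B'))).
Proof.
move=> numu numu'.
rewrite (attach_energy _ (fam_test_function AB _) (fam_test_function AB' _) (glue_eq x)).
by rewrite !fam_energy// opprD.
Qed.

Lemma attach_space_energy_le0 mu x : (forall i, nu i <= mu) ->
  (forall i, nu' i <= mu) ->
  @energy _ (attach v0 w1) mu (attach_g x) (attach_dg x) (attach_c x) <= 0.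
Proof.
move=> numu numu'; rewrite attach_space_energy// oppr_le0.
by rewrite addr_ge0// inner_ge0.
Qed.

(* Equality forces the function to be a multiple of the last eigenfunction of
   [G], which does not satisfy the gluing condition. *)
Lemma attach_space_energy_lt0 mu x i0 : (forall i, nu i <= mu) ->
  (forall i, i != i0 -> nu i < mu) -> (forall i, nu' i < mu) ->
  c i0 v0 != 0 -> x != 0 ->
  @energy _ (attach v0 w1) mu (attach_g x) (attach_dg x) (attach_c x) < 0.
Proof.
move=> numu numu_lt numu' ci0 x0.
have numu'_le i : nu' i <= mu by exact: ltW.
rewrite lt_neqAle attach_space_energy_le0// andbT.
apply: contra_neq x0; rewrite attach_space_energy// => /eqP.
rewrite oppr_eq0 paddr_eq0 ?inner_ge0// => /andP[/eqP hl /eqP hr].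
have dl := fam_inner_eq0 hl ff; have dr := fam_inner_eq0 hr ff'.
have r0 : yr x = 0.
  by apply/rowP => i; rewrite (damp_eq0 dr (numu' i)) mxE.
have l0 i : i != i0 -> yl x 0 i = 0 by move=> ii0; rewrite (damp_eq0 dl (numu_lt i ii0)).
apply: y_eq0 => //; apply/rowP => i; rewrite [RHS]mxE.
have [->|/l0//] := eqVneq i i0.
have := glue_eq x; rewrite r0 /vcomb [RHS]big1 => [|j _]; last by rewrite mxE mul0r.
rewrite (bigD1 i0)//= big1 ?addr0 => [/eqP|j /l0 ->]; last by rewrite mul0r.
by rewrite mulf_eq0 (negbTE ci0) orbF => /eqP.
Qed.

End AttachSpace.

Theorem attach_below G H (v0 : vertex G) (w1 : vertex H) k r mu :
  eigenvalues_below G k mu -> eigenvalues_below H r mu ->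
  eigenvalues_below (attach v0 w1) (k + r - 1) mu.
Proof.
move=> /below_family[nu [A [B [c [numu AB ff]]]]].
move=> /below_family[nu' [A' [B' [c' [numu' AB' ff']]]]].
have [|X [fX X0]] := @row_free_kernel _ (k + r - 1) _
    (\col_i cat_fun (c ^~ v0) (fun j => - c' j w1) i).
  by rewrite subn1.
apply: (eigenvalues_below_of_test_space (attach_test_space AB AB' ff ff' fX X0)).
by move=> x; apply: attach_space_energy_le0.
Qed.

(** Here [k] counts the eigenvalues of [G] strictly below mu, one less than the index of mu itself;
    [f] supplies the missing dimension. *)
Theorem attach_below_lt G H (v0 : vertex G) (w1 : vertex H) k r mu s t f :
  eigenvalues_below G k s -> s < mu -> eigenvalues_below H r t -> t < mu ->
  eigenfunction mu f -> nonvanishing_at v0 f ->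
  exists2 s', s' < mu & eigenvalues_below (attach v0 w1) (k + 1 + r - 1) s'.
Proof.
move=> Gk smu /below_family[nu' [A' [B' [c' [nut AB' ff']]]]] tmu fE fv0.
have [nu [A [B [c [numu numu_lt AB ff cv0]]]]] := family_rcons Gk smu fE fv0.
have [|X [fX X0]] := @row_free_kernel _ (k + 1 + r - 1) _
    (\col_i cat_fun (c ^~ v0) (fun j => - c' j w1) i).
  by rewrite subn1.
apply: (eigenvalues_below_lt_of_test_space (attach_test_space AB AB' ff ff' fX X0)).
move=> x x0; apply: (attach_space_energy_lt0 AB AB' ff ff' fX X0 numu _ _ cv0 x0).
- move=> i; rewrite -(splitK i); case: fintype.split => j /=; first by rewrite numu_lt.
  by rewrite ord1 eqxx.
- by move=> i; exact: le_lt_trans tmu.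
Qed.

Section InsertSpace.
Variables (G H : metric_graph R) (v0 : vertex G).
Variables (w : edge G -> bool -> vertex H) (s : vertex H -> R).
Hypothesis natural : forall u, strength H u = 0%E.
Hypothesis strength_v0 : strength G v0 = (\sum_(u | insert_used v0 w u) s u)%:E.
Variables (n : nat) (nu : 'I_n -> R) (A B : 'I_n -> edge G -> R).
Variable c : 'I_n -> vertex G -> R.
Hypothesis AB : forall i, eigen_data (nu i) (A i) (B i) (c i).
Hypothesis ff : lin_free (fam_sol nu A B).

Definition insert_g (x : 'rV[R]_n) : edge G + edge H -> R -> R :=
  insert_fun (comb x (fam_sol nu A B)) (vcomb x c v0).
Definition insert_dg (x : 'rV[R]_n) : edge G + edge H -> R -> R :=
  insert_fun (comb x (fam_dsol nu A B)) 0.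
Definition insert_c (x : 'rV[R]_n) := insert_value (H := H) (v0 := v0) (vcomb x c).

Lemma insert_test_space :
  @test_space _ (insert v0 w s) n insert_g insert_dg insert_c.
Proof.
split=> [x|e t a x x'|v a x x'|x x0].
- by apply: insert_test_function => //; exact: fam_test_function.
- by case: e => e; rewrite /insert_g /= ?comb_linear ?vcomb_linear.
- by case: v => [[v vv0]|u]; rewrite /insert_c /= vcomb_linear.
- by apply: ff => e t et; exact: (x0 (inl e) t et).
Qed.

Lemma insert_space_energy mu x : (forall i, nu i <= mu) ->
  @energy _ (insert v0 w s) mu (insert_g x) (insert_dg x) (insert_c x) =
  - (inner (comb (damp nu mu x) (fam_sol nu A B))
           (comb (damp nu mu x) (fam_sol nu A B)) +
     mu * vcomb x c v0 ^+ 2 * \sum_e len H e).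
Proof. by move=> numu; rewrite insert_energy// fam_energy// opprD. Qed.

Lemma sum_len_gt0 : 0 < \sum_e len H e.
Proof.
have /card_gt0P[e _] := edge_gt0 H.
rewrite (bigD1 e)//= ltr_wpDr ?len_gt0//.
by apply: sumr_ge0 => e' _; rewrite ltW// len_gt0.
Qed.

Lemma insert_space_energy_le0 mu x : 0 <= mu -> (forall i, nu i <= mu) ->
  @energy _ (insert v0 w s) mu (insert_g x) (insert_dg x) (insert_c x) <= 0.
Proof.
move=> mu0 numu; rewrite insert_space_energy// oppr_le0 addr_ge0 ?inner_ge0//.
by rewrite mulr_ge0 ?(ltW sum_len_gt0)// mulr_ge0 ?sqr_ge0.
Qed.

(** If the form vanishes, the damped part kills every coordinate but [i0], and the mass on [H],
    where [0 < mu] enters, forces the value at [v0] to be 0. *)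
Lemma insert_space_energy_lt0 mu x i0 : 0 < mu -> (forall i, nu i <= mu) ->
  (forall i, i != i0 -> nu i < mu) -> c i0 v0 != 0 -> x != 0 ->
  @energy _ (insert v0 w s) mu (insert_g x) (insert_dg x) (insert_c x) < 0.
Proof.
move=> mu0 numu numu_lt ci0 x0.
rewrite lt_neqAle insert_space_energy_le0 ?(ltW mu0)// andbT.
apply: contra_neq x0; rewrite insert_space_energy// => /eqP.
rewrite oppr_eq0 paddr_eq0 ?inner_ge0//; last first.
  by rewrite mulr_ge0 ?(ltW sum_len_gt0)// mulr_ge0 ?sqr_ge0// ltW.
rewrite !mulf_eq0 (gt_eqF mu0) (gt_eqF sum_len_gt0) orbF orbb/=.
move=> /andP[/eqP hl /eqP v00].
have dl := fam_inner_eq0 hl ff.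
have l0 i : i != i0 -> x 0 i = 0 by move=> ii0; rewrite (damp_eq0 dl (numu_lt i ii0)).
apply/rowP => i; rewrite [RHS]mxE.
have [->|/l0//] := eqVneq i i0.
move: v00; rewrite /vcomb (bigD1 i0)//= big1 ?addr0 => [/eqP|j /l0 ->]; last by rewrite mul0r.
by rewrite mulf_eq0 (negbTE ci0) orbF => /eqP.
Qed.

End InsertSpace.

Theorem insert_below G H (v0 : vertex G) w (s : vertex H -> R) k mu :
  (forall u, strength H u = 0%E) ->
  strength G v0 = (\sum_(u | insert_used v0 w u) s u)%:E -> 0 <= mu ->
  eigenvalues_below G k mu -> eigenvalues_below (insert v0 w s) k mu.
Proof.
move=> natH sv0 mu0 /below_family[nu [A [B [c [numu AB ff]]]]].
apply: (eigenvalues_below_of_test_space (insert_test_space v0 w s natH AB ff)).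
by move=> x; apply: insert_space_energy_le0.
Qed.

Theorem insert_below_lt G H (v0 : vertex G) w (s : vertex H -> R) k mu t f :
  (forall u, strength H u = 0%E) ->
  strength G v0 = (\sum_(u | insert_used v0 w u) s u)%:E -> 0 < mu ->
  eigenvalues_below G k t -> t < mu -> eigenfunction mu f ->
  nonvanishing_at v0 f ->
  exists2 s', s' < mu & eigenvalues_below (insert v0 w s) (k + 1) s'.
Proof.
move=> natH sv0 mu0 Gk tmu fE fv0.
have [nu [A [B [c [numu numu_lt AB ff cv0]]]]] := family_rcons Gk tmu fE fv0.
apply: (eigenvalues_below_lt_of_test_space (insert_test_space v0 w s natH AB ff)).
move=> x x0; apply: (insert_space_energy_lt0 natH sv0 AB ff mu0 numu _ cv0 x0).
move=> i; rewrite -(splitK i); case: fintype.split => j /=; first by rewrite numu_lt.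
by rewrite ord1 eqxx.
Qed.

End Comparison.

Theorem theorem3p10 (R : realType) (G H : metric_graph R) (v0 : vertex G) :
  (* (1) attaching a pendant graph *)
  (forall (w1 : vertex H) (r k : nat),
     (1 <= r)%N -> (1 <= k)%N ->
     (lambda H r <= lambda G k)%E ->
     (lambda (attach v0 w1) (k + r - 1) <= lambda G k)%E /\
     (has_eigenfunction_nonvanishing_at v0 k ->
      (lambda G (k - 1) < lambda G k)%E ->
      (lambda H r < lambda G k)%E ->
      (lambda (attach v0 w1) (k + r - 1) < lambda G k)%E))
  /\
  (* (2) inserting a graph at a vertex *)
  (forall (w : edge G -> bool -> vertex H) (s : vertex H -> R),
     (forall u, strength H u = 0%E) ->
     strength G v0 = (\sum_(u | insert_used v0 w u) s u)%:E ->
     forall k : nat,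
     (1 <= k)%N ->
     (0 <= lambda G k)%E ->
     (lambda (insert v0 w s) k <= lambda G k)%E /\
     ((maxe 0 (lambda G (k - 1)) < lambda G k)%E ->
      has_eigenfunction_nonvanishing_at v0 k ->
      (lambda (insert v0 w s) k < lambda G k)%E)).
Proof.
split=> [w1 r k r1 k1 HG|w s natH sv0 k k1 G0]; split.
- apply: le_lambda => t Gt; apply: lambda_le; apply: attach_below.
    exact: lambda_lt_below.
  exact: lambda_lt_below (le_lt_trans HG Gt).
(* The gap yields [k - 1] eigenvalues at most some [t < mu]; [subnK] then restores [k - 1 + 1] to
   [k], using [1 <= k]. *)
- move=> [mu [f [-> fE fv0]]] /lambda_lt[t tmu Gt] /lambda_lt[t' t'mu Ht'].
  have [s smu] := attach_below_lt w1 Gt tmu Ht' t'mu fE fv0.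
  rewrite subnK// => /lambda_le/le_lt_trans; apply.
  by rewrite lte_fin.
- apply: le_lambda => t Gt; apply: lambda_le; apply: insert_below => //.
    by rewrite -lee_fin ltW// (le_lt_trans G0).
  exact: lambda_lt_below.
- move=> + [mu [f [Gk fE fv0]]]; rewrite Gk gt_max => /andP[mu0 /lambda_lt[t tmu Gt]].
  rewrite lte_fin in mu0.
  have [t' t'mu] := insert_below_lt natH sv0 mu0 Gt tmu fE fv0.
  rewrite subnK// => /lambda_le/le_lt_trans; apply.
  by rewrite lte_fin.
Qed.
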